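(* Let $X$ be a Banach space and $G$ a compact topological group acting on $X$. If $X^*$ is $G$-strongly subdifferentiable ($G$-SSD), then $X$ is $G$-reflexive.
   Context: $X$ is a Banach space over $\mathbb{K}=\mathbb{R}$ or $\mathbb{C}$; $S_X$, $B_X$ are the unit sphere and closed unit ball. A compact topological group $G$ acting on $X$ means: a group $G\subseteq\mathcal{L}(X)$ (under composition) of linear isometric isomorphisms of $X$ onto itself, compact for the relative topology inherited from $\mathcal{L}(X)$. $X_G=\{x\in X: g(x)=x\ \forall g\in G\}$. $X_G^*=\{f\in X^*: f(g(x))=f(x)\ \forall x\in X, g\in G\}$, i.e. the functionals fixed by all adjoints $g^*$, $g\in G$. $X^{**}_{G^{**}}=\{x^{**}\in X^{**}: g^{**}(x^{**})=x^{**}\ \forall g\in G\}$. Let $\pi:X\to X^{**}$ be the canonical injection. $X$ is $G$-reflexive if $\pi(X_G)=X^{**}_{G^{**}}$. $X^*$ is $G$-SSD (with respect to the dual group $G^*=\{g^*: g\in G\}$) if for every $u\in S_{X_G^*}$ (that is, $u\in X_G^*$ with $\|u\|=1$) the limit $\lim_{t\to0^+}\frac{\|u+tz\|-1}{t}$ exists uniformly for $z\in B_{X_G^*}$ (the closed unit ball of $X_G^*$). *)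

(* Defs.v *)
From HB Require Import structures.
From mathcomp Require Import all_boot all_order all_algebra complex.
From mathcomp Require Import all_classical all_reals all_analysis.

Set Implicit Arguments.
Unset Strict Implicit.
Unset Printing Implicit Defensive.

Import Order.TTheory GRing.Theory Num.Theory.
Import numFieldNormedType.Exports.

Local Open Scope classical_set_scope.
Local Open Scope ring_scope.

(* In a normed module over K, norms are K-valued. For K = R[i], the order on K
   is the partial order in which x <= y iff y - x is real and nonnegative, so
   that norms are nonnegative real elements of K. *)
Inductive real_or_complex : numFieldType -> Prop :=
| scalars_real (R : realType) : real_or_complex R
| scalars_complex (R : realType) : real_or_complex R[i].

Lemma real_or_complex_supremums (K : numFieldType) (hK : real_or_complex K)
    (A : set K) :
  A !=set0 -> A `<=` [set x | 0 <= x] -> has_ubound A -> supremums A !=set0.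
Proof.
case: K / hK A => R A [a Aa] A0 [M ubM].
  have hA : has_sup A by split; [exists a | exists M].
  exists (sup A); split; first by move=> x Ax; exact: ub_le_sup hA.2 _ Ax.
  by move=> b ubb; exact: ge_sup hA.1 ubb.
pose B : set R := @complex.Re R @` A.
have ReE (x : R[i]) : 0 <= x -> x = (complex.Re x)%:C%C.
  by case: x => u v; rewrite lecE/= => /andP[/eqP-> _].
have ubB b : ubound A b -> ubound B (complex.Re b).
  by move=> ubb _ [x Ax <-]; have := ubb _ Ax; rewrite lecE => /andP[].
have hB : has_sup B.
  by split; [exists (complex.Re a), a | exists (complex.Re M); exact: ubB].
exists (sup B)%:C%C; split.
  move=> x Ax; rewrite (ReE _ (A0 _ Ax)) lecR.
  by apply: ub_le_sup hB.2 _ _; exists x.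
move=> b ubb.
have b0 : 0 <= b by apply: le_trans (A0 _ Aa) (ubb _ Aa).
rewrite (ReE _ b0) lecR; apply: ge_sup hB.1 _; exact: ubB.
Qed.

Definition continuous_linear (K : numFieldType) (V W : normedModType K) :
  {pred V -> W} := [pred f | `[< linear f /\ continuous f >]].

Lemma continuous_linear_closed (K : numFieldType) (V W : normedModType K) :
  GRing.subsemimod_closed (@continuous_linear K V W).
Proof.
have lin (f : V -> W) : linear f -> (forall x y, f (x + y) = f x + f y) *
    (forall k x, f (k *: x) = k *: f x).
  move=> lf; have f0 : f 0 = 0.
    by have := lf (-1) 0 0; rewrite scaler0 addr0 scaleN1r addNr.
  split=> [x y|k x]; first by have := lf 1 x y; rewrite !scale1r.
  by have := lf k x 0; rewrite f0 !addr0.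
split; first split.
- apply/asboolP; split; last by move=> x; exact: cvg_cst.
  by move=> k x y /=; rewrite /GRing.zero/= scaler0 addr0.
- move=> f g /asboolP[/lin lf cf] /asboolP[/lin lg cg]; apply/asboolP; split.
    move=> k x y.
    by rewrite /GRing.add/= !lf !lg scalerDr addrACA.
  by move=> x; exact: (@continuousD _ _ _ f g _ (cf x) (cg x)).
- move=> c f /asboolP[/lin lf cf]; apply/asboolP; split.
    have cfE x : (c *: f) x = c *: f x by [].
    by move=> k x y; rewrite !cfE !lf scalerDr !scalerA mulrC.
  by move=> x; apply: continuousZl_tmp; exact: cf.
Qed.

HB.instance Definition _ (K : numFieldType) (V W : normedModType K) :=
  GRing.isSubmodClosed.Build K (V -> W) (@continuous_linear K V W)
    (@continuous_linear_closed K V W).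

(* The phantom argument hK keeps the restriction on the scalar field available
   to the normed module structure below: without it, the supremum defining the
   operator norm need not exist. *)
Record bounded_op (K : numFieldType) (hK : real_or_complex K)
    (V W : normedModType K) := BoundedOp {
  bounded_op_fun :> V -> W;
  _ : bounded_op_fun \in @continuous_linear K V W
}.

Section bounded_op_normed.
Context (K : numFieldType) (hK : real_or_complex K) (V W : normedModType K).

HB.instance Definition _ := [isSub for @bounded_op_fun K hK V W].
HB.instance Definition _ := [Choice of bounded_op hK V W by <:].
HB.instance Definition _ := [SubChoice_isSubLmodule of bounded_op hK V W by <:].

Lemma bounded_op_is_linear (f : bounded_op hK V W) : linear f.
Proof. by case: f => f /= /asboolP[]. Qed.

HB.instance Definition _ (f : bounded_op hK V W) :=
  GRing.isLinear.Build K V W *:%R f (bounded_op_is_linear f).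

Lemma bounded_op_continuous (f : bounded_op hK V W) : continuous f.
Proof. by case: f => f /= /asboolP[]. Qed.

Lemma bounded_opP (f g : bounded_op hK V W) : f =1 g -> f = g.
Proof. by move=> fg; apply/val_inj/funext. Qed.

Definition op_norm (f : bounded_op hK V W) : K :=
  supremum 0 [set `|f x| | x in [set x | `|x| <= 1]].

Lemma op_norm_supremums (f : bounded_op hK V W) :
  supremums [set `|f x| | x in [set x | `|x| <= 1]] (op_norm f).
Proof.
set A := [set _ | _ in _].
have A0 : A !=set0 by exists `|f 0|, 0 => //=; rewrite normr0 ler01.
have [s As] : supremums A !=set0.
  apply: (real_or_complex_supremums hK) => //; first by move=> _ [x _ <-] /=.
  have := @bounded_op_continuous f.
  move=> /linear_bounded_continuous/linear_boundedP/pinfty_ex_gt0[r r0 fr].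
  exists r => _ [x /= x1 <-]; apply: le_trans (fr x) _.
  by rewrite -[leRHS]mulr1 ler_pM2l.
rewrite /op_norm /supremum; rewrite -/A; case: ifPn => [/eqP AE|_].
  by move: A0; rewrite AE => -[].
by case: xgetP => [x -> //|/(_ s)].
Qed.

Lemma op_norm_ub (f : bounded_op hK V W) x : `|x| <= 1 -> `|f x| <= op_norm f.
Proof. by move=> x1; apply: (op_norm_supremums f).1; exists x. Qed.

Lemma op_norm_least (f : bounded_op hK V W) b :
  (forall x, `|x| <= 1 -> `|f x| <= b) -> op_norm f <= b.
Proof.
by move=> fb; apply: (op_norm_supremums f).2 => _ [x /= x1 <-]; exact: fb.
Qed.

Lemma op_norm_ge0 (f : bounded_op hK V W) : 0 <= op_norm f.
Proof.
by apply: le_trans (normr_ge0 (f 0)) (op_norm_ub _ _); rewrite normr0 ler01.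
Qed.

Lemma op_norm_bound (f : bounded_op hK V W) x : `|f x| <= op_norm f * `|x|.
Proof.
have [->|x0] := eqVneq x 0; first by rewrite linear0 !normr0 mulr0.
have x_gt0 : 0 < `|x| by rewrite normr_gt0.
rewrite -ler_pdivrMr// mulrC.
have := @op_norm_ub f (`|x|^-1 *: x).
rewrite linearZ/= !normrZ ger0_norm ?invr_ge0//; apply.
by rewrite mulVf// gt_eqF.
Qed.

Lemma op_norm_triangle (f g : bounded_op hK V W) :
  op_norm (f + g) <= op_norm f + op_norm g.
Proof.
apply: op_norm_least => x x1; apply: le_trans (ler_normD (f x) (g x)) _.
by apply: lerD; exact: op_norm_ub.
Qed.

Lemma op_normZ (k : K) (f : bounded_op hK V W) :
  op_norm (k *: f) = `|k| * op_norm f.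
Proof.
have le_Z c (h : bounded_op hK V W) : op_norm (c *: h) <= `|c| * op_norm h.
  apply: op_norm_least => x x1; have -> : (c *: h) x = c *: h x by [].
  by rewrite normrZ ler_wpM2l// op_norm_ub.
have [->|k0] := eqVneq k 0.
  by apply/eqP; rewrite eq_le le_Z normr0 mul0r op_norm_ge0.
apply/eqP; rewrite eq_le le_Z/=.
rewrite -ler_pdivlMl ?normr_gt0// -normfV.
by apply: le_trans (le_Z _ _); rewrite scalerA mulVf// scale1r.
Qed.

Lemma op_norm0_eq0 (f : bounded_op hK V W) : op_norm f = 0 -> f = 0.
Proof.
move=> f0; apply: bounded_opP => x; apply/eqP; rewrite -normr_le0.
by have := op_norm_bound f x; rewrite f0 mul0r.
Qed.

HB.instance Definition _ := Lmodule_isNormed.Build K (bounded_op hK V W)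
  op_norm_triangle op_normZ op_norm0_eq0.

Lemma bounded_continuous_linear (f : V -> W) (M : K) :
  linear f -> 0 <= M -> (forall x, `|f x| <= M * `|x|) ->
  f \in @continuous_linear K V W.
Proof.
move=> lf M0 fM; apply/asboolP; split => //.
pose fL := GRing.isLinear.Build K V W *:%R f lf.
pose g : {linear V -> W} := HB.pack f fL.
apply: (@bounded_linear_continuous _ _ _ g); apply/linear_boundedP.
exists M; split; first exact: ger0_real.
by move=> r /ltW Mr x; apply: le_trans (fM x) _; rewrite ler_wpM2r.
Qed.

End bounded_op_normed.

Section composition.
Context (K : numFieldType) (hK : real_or_complex K).

Lemma id_op_subproof (V : normedModType K) :
  @idfun V \in @continuous_linear K V V.
Proof. by apply/asboolP; split => // x; exact: cvg_id. Qed.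

Definition id_op (V : normedModType K) : bounded_op hK V V :=
  BoundedOp hK (id_op_subproof V).

Lemma comp_op_subproof (U V W : normedModType K)
    (g : bounded_op hK V W) (f : bounded_op hK U V) :
  g \o f \in @continuous_linear K U W.
Proof.
apply/asboolP; split; first by move=> k x y /=; rewrite !linearP.
by move=> x; apply: continuous_comp; exact: bounded_op_continuous.
Qed.

Definition comp_op (U V W : normedModType K)
    (g : bounded_op hK V W) (f : bounded_op hK U V) : bounded_op hK U W :=
  BoundedOp hK (comp_op_subproof g f).

Definition dual (V : normedModType K) : normedModType K :=
  bounded_op hK V K^o.

Definition bidual (V : normedModType K) : normedModType K := dual (dual V).

Lemma adjoint_subproof (V W : normedModType K) (g : bounded_op hK V W) :
  (fun f : dual W => comp_op f g : dual V)
    \in @continuous_linear K (dual W) (dual V).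
Proof.
apply: (@bounded_continuous_linear _ _ _ _ (op_norm g)) => //.
- by move=> k f h; exact: bounded_opP.
- exact: op_norm_ge0.
move=> f; apply: op_norm_least => x x1 /=.
apply: le_trans (op_norm_bound f (g x)) _.
rewrite [leRHS]mulrC; apply: ler_wpM2l; first exact: op_norm_ge0.
exact: op_norm_ub.
Qed.

Definition adjoint (V W : normedModType K) (g : bounded_op hK V W) :
  bounded_op hK (dual W) (dual V) := BoundedOp hK (adjoint_subproof g).

Lemma canonical_injection_subproof (V : normedModType K) (x : V) :
  (fun f : dual V => f x : K^o) \in @continuous_linear K (dual V) K^o.
Proof.
by apply: (@bounded_continuous_linear _ _ _ _ `|x|) => // f;
  rewrite mulrC; exact: op_norm_bound.
Qed.

Definition canonical_injection (V : normedModType K) (x : V) : bidual V :=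
  BoundedOp hK (canonical_injection_subproof x).

End composition.

Section group_action.
Context (K : numFieldType) (hK : real_or_complex K) (X : normedModType K).

(* Compactness refers to the operator norm topology of bounded_op hK X X. *)
Record compact_isometry_group (G : set (bounded_op hK X X)) : Prop := {
  group_isometry : forall g, G g -> forall x, `|g x| = `|x|;
  group_onto : forall g, G g -> forall y, exists x, g x = y;
  group_id : G (id_op hK X);
  group_comp : forall g h, G g -> G h -> G (comp_op g h);
  group_inv : forall g, G g -> exists2 h, G h &
    comp_op g h = id_op hK X /\ comp_op h g = id_op hK X;
  group_compact : compact G
}.

Variable G : set (bounded_op hK X X).

Definition fixed_points : set X := [set x | forall g, G g -> g x = x].

Definition dual_fixed_points : set (dual hK X) :=
  [set f | forall x g, G g -> f (g x) = f x].

Definition bidual_fixed_points : set (bidual hK X) :=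
  [set phi | forall g, G g -> adjoint (adjoint g) phi = phi].

Definition G_reflexive : Prop :=
  @canonical_injection K hK X @` fixed_points = bidual_fixed_points.

(* The parameter t ranges over K, but 0 < t forces t to be real when K = R[i],
   so 0^'+ is the usual filter of positive reals tending to 0. *)
Definition dual_G_SSD : Prop :=
  forall u : dual hK X, dual_fixed_points u -> `|u| = 1 ->
  exists l : dual hK X -> K^o,
    {uniform dual_fixed_points `&` [set z | `|z| <= 1],
      (fun (t : K) (z : dual hK X) => (`|u + t *: z| - 1) / t : K^o) @ 0^'+
      --> l}.

End group_action.

(* Main.v *)
(* Averaging over a finite net of the compact group [G] shrinks the diameter of
   orbits, both in [X] and in its dual, and this yields fixed points in the
   closed convex hulls of orbits. They play the role of Haar averages: if [phi]
   is fixed by the biadjoints and [x] averages [e], then [|phi - x|] on the whole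
   dual is controlled by [|phi - e|] on the space [Y] of fixed functionals. So it
   suffices to approximate [phi] on [Y] by evaluations at points of [X], and by
   Hahn-Banach this is possible within [t] as soon as [|phi| <= t] on the
   functionals of [Y] of norm at most 1 that vanish at finitely many points.

   Suppose this fails for some [t]. Then for all finite [s] the convex set
   [C s] of the [y] in [Y] with [|y| <= 1], [y = 0] on [s] and [phi y = t] is
   nonempty. As in James' theorem, build [v_(k+1) = v_k + 2^-(k+1) y_k] where
   [d_k] almost norms [v_k] and [y_k] almost minimizes [|v_k + 2^-k y|] over
   [C {d_0, .., d_k}]. Let [u] be the limit and [w_k = 2^k (u - v_k)], which is
   again in [C {d_0, .., d_k}]. The minimality gives
   [|u - 2^-k w_k| <= |u| - 2^-k e], while for a fixed step [r] testing at [d_i]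
   gives [|u - r w_k| >= |u (d_i)| >= |u| - 3 2^-i] for all [k >= i]: the
   difference quotients at [u] do not converge uniformly. *)

From HB Require Import structures.
Require Import Defs.
From mathcomp Require Import all_boot all_order all_algebra.
From mathcomp Require Import all_classical all_reals all_analysis.
From mathcomp Require Import complex ring.

Set Implicit Arguments.
Unset Strict Implicit.
Unset Printing Implicit Defensive.

Import Order.TTheory GRing.Theory Num.Theory.
Import numFieldNormedType.Exports.

Local Open Scope classical_set_scope.
Local Open Scope ring_scope.

(** * Scalars *)

Section scalars.
Context (K : numFieldType) (hK : real_or_complex K).

Lemma scalar_natr_bound (x : K) : 0 <= x -> exists n : nat, x < n%:R.
Proof.
case: K / hK x => R x x0; first by exists (Num.bound x); exact: archi_boundP.
case: x x0 => a b; rewrite lecE/= => /andP[/eqP-> a0].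
exists (Num.bound a); have := archi_boundP a0.
by rewrite -(rmorph_nat (real_complex R)) ltcR.
Qed.

Lemma exp_half_lt (C e : K) : 0 <= C -> 0 < e -> exists n, C * 2 ^- n < e.
Proof.
move=> C0 e0; have [n Cn] := scalar_natr_bound (divr_ge0 C0 (ltW e0)).
exists n; rewrite ltr_pdivrMr ?exprn_gt0// mulrC -ltr_pdivrMr//.
by apply: lt_trans Cn _; rewrite -natrX ltr_nat ltn_expl.
Qed.

(** Stands in for passing to the limit: the sequences below converge at geometric rates, so only
    errors of the form [C * 2 ^- n] have to be discarded. *)
Lemma ler_exp_half (C x y : K) :
  0 <= C -> (forall n, x <= y + C * 2 ^- n) -> x <= y.
Proof.
move=> C0 xy; apply/ler_addgt0Pr => e e0.
by have [n /ltW Cn] := exp_half_lt C0 e0; apply: le_trans (xy n) _; rewrite lerD2l.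
Qed.

(** The infimum is the supremum of the lower bounds above [m]; subtracting [m] makes them
    nonnegative, as [real_or_complex_supremums] requires. *)
Lemma scalar_glb (A : set K) (m : K) : A !=set0 -> (forall a, A a -> m <= a) ->
  exists s, [/\ m <= s, forall a, A a -> s <= a &
    forall b, (forall a, A a -> b <= a) -> b <= s].
Proof.
move=> [a0 Aa0] mA.
pose B : set K :=
  [set c | exists b, [/\ c = b - m, m <= b & forall a, A a -> b <= a]].
have Bm : B (m - m) by exists m.
have ubB a : A a -> ubound B (a - m).
  by move=> Aa _ [b [-> _ bA]]; rewrite lerD2r bA.
have [||s [ubs lubs]] := @real_or_complex_supremums K hK B _ _ (ex_intro _ _ (ubB a0 Aa0)).
- by exists (m - m).
- by move=> _ [b [-> mb _]] /=; rewrite subr_ge0.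
have ms : m <= m + s by rewrite lerDl -(subrr m) ubs.
exists (m + s); split=> // [a Aa|b bA].
  by rewrite addrC -lerBrDr; apply: lubs; exact: ubB.
(* The order of [K] may be partial, so [b] and [m] are compared through their common upper bound
   [a0]. *)
have : b - m \is Num.real.
  rewrite -(subrKA a0) rpredD//; first by rewrite ler0_real// subr_le0 bA.
  by rewrite ger0_real// subr_ge0 mA.
rewrite realE subr_ge0 subr_le0 => /orP[mb|bm]; last exact: le_trans ms.
by rewrite addrC -lerBlDr; apply: ubs; exists b.
Qed.

Lemma exists_near_minimizer (T : Type) (A : set T) (h : T -> K) (e : K) :
  A !=set0 -> (forall a, 0 <= h a) -> 0 < e ->
  exists2 a, A a & forall b, A b -> h a <= h b + e.
Proof.
move=> [a0 Aa0] h0 e0.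
have [||s [s0 sA slub]] := @scalar_glb (h @` A) 0.
- by exists (h a0), a0.
- by move=> _ [a _ <-].
apply: contrapT => nA.
suff : s + e <= s by rewrite gerDl lt_geF.
apply: slub => _ [a Aa <-]; rewrite real_leNgt ?ger0_real ?addr_ge0// ?(ltW e0)//.
apply/negP => /ltW hae; apply: nA; exists a => // b Ab.
by apply: le_trans hae _; rewrite lerD2r sA//; exists b.
Qed.

End scalars.

(** * Completeness along geometrically convergent sequences *)

Definition geometrically_complete (K : numFieldType) (V : normedModType K) :=
  forall (C : K) (w : nat -> V), 0 <= C ->
    (forall n, `|w n.+1 - w n| <= C * 2 ^- n) ->
  exists l, forall n, `|l - w n| <= 4 * C * 2 ^- n.

Lemma exp_halfS (K : numFieldType) (n : nat) :
  2 ^- n = 2 ^- n.+1 + 2 ^- n.+1 :> K.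
Proof.
by rewrite -mulr2n -[RHS]mulr_natr exprSr invfM mulrAC -mulrA mulfV ?pnatr_eq0// mulr1.
Qed.

Lemma exp_half_gt0 (K : numFieldType) n : 0 < 2 ^- n :> K.
Proof. by rewrite invr_gt0 exprn_gt0. Qed.

Lemma exp_half_le (K : numFieldType) m n : (m <= n)%N -> 2 ^- n <= 2 ^- m :> K.
Proof. by move=> mn; rewrite lef_pV2 ?posrE ?exprn_gt0// ler_eXn2l// ltr1n. Qed.

(** The bound is the exact value of the geometric sum of the increments, so the induction on [m]
    closes with an equality. *)
Lemma geometric_dist (K : numFieldType) (V : normedModType K) (C : K)
    (w : nat -> V) : (forall n, `|w n.+1 - w n| <= C * 2 ^- n) ->
  forall m n, (n <= m)%N -> `|w m - w n| <= 2 * C * 2 ^- n - 2 * C * 2 ^- m.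
Proof.
move=> wC m n; elim: m => [|m IH].
  by rewrite leqn0 => /eqP->; rewrite !subrr normr0.
rewrite leq_eqVlt => /orP[/eqP->|]; first by rewrite !subrr normr0.
rewrite ltnS => /IH{}IH; rewrite -(subrKA (w m)).
apply: le_trans (ler_normD _ _) _; apply: le_trans (lerD (wC m) IH) _.
rewrite (exp_halfS K m) le_eqVlt; apply/orP; left; apply/eqP; ring.
Qed.

(** Real functionals take their values inside [K], so that real parts of [K]-linear functionals are
    covered for both scalar fields. *)
Definition real_linear (K : numFieldType) (V : lmodType K) (f : V -> K) :=
  [/\ forall x, f x \is Num.real, {morph f : x y / x + y} &
      forall t x, t \is Num.real -> f (t *: x) = t * f x].

Section completeness.
Context (K : numFieldType) (hK : real_or_complex K).

(** The limit is the infimum of the upper estimates [w n + e n]; it dominates the lower estimates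
    [w m - e m], each of which lies below every upper one. *)
Lemma real_geometric_limit (C : K) (w : nat -> K) : 0 <= C ->
  (forall n, w n \is Num.real) -> (forall n, `|w n.+1 - w n| <= C * 2 ^- n) ->
  exists l, forall n, `|l - w n| <= 2 * C * 2 ^- n.
Proof.
move=> C0 wR wC; pose e n : K := 2 * C * 2 ^- n.
have e0 n : 0 <= e n by rewrite !mulr_ge0// ltW// exp_half_gt0.
have eR n : e n \is Num.real by rewrite ger0_real.
have dist m n : `|w m - w n| <= e n + e m.
  wlog nm : m n / (n <= m)%N.
    by move=> h; have [/h//|/ltnW/h] := leqP n m; rewrite distrC (addrC (e m)).
  apply: le_trans (@geometric_dist _ K^o C w wC _ _ nm) _.
  by rewrite lerD2l (le_trans _ (e0 m))// oppr_le0; exact: e0.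
have lowup m n : w m - e m <= w n + e n.
  have := dist m n; rewrite real_ler_norml ?rpredB// => /andP[_].
  by rewrite lerBlDl addrA -lerBlDr.
have [||s [ms sA As]] :=
    @scalar_glb K hK [set w n + e n | n in [set: nat]] (w 0%N - e 0%N).
- by exists (w 0%N + e 0%N), 0%N.
- by move=> _ [n _ <-]; exact: lowup.
have sR : s \is Num.real.
  by rewrite -(subrK (w 0%N - e 0%N) s) rpredD ?(rpredB (wR _))// ger0_real// subr_ge0.
exists s => n; rewrite real_ler_norml ?rpredB//; apply/andP; split.
  by rewrite lerBrDl; apply: As => _ [m _ <-]; exact: lowup.
by rewrite lerBlDl; apply: sA; exists n.
Qed.

End completeness.

(** In the complex case, real and imaginary parts converge separately with constant 2 and their
    errors add up: hence the 4 in [geometrically_complete]. *)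
Lemma scalar_complete (K : numFieldType) (hK : real_or_complex K) :
  geometrically_complete (K^o : normedModType K).
Proof.
case: K / hK => R C w C0 wC.
  have [|l lw] := real_geometric_limit (scalars_real R) C0 _ wC.
    by move=> n; exact: num_real.
  exists l => n; apply: le_trans (lw n) _.
  by rewrite -!mulrA ler_wpM2r ?ler_nat// mulr_ge0// ltW// exp_half_gt0.
pose C' : R[i] := C; pose z n : R[i] := w n.
have part (p : R[i] -> R[i]) : (forall x, p x \is Num.real) ->
    (forall x y, p (x - y) = p x - p y) -> (forall x, `|p x| <= `|x|) ->
    exists l, forall n, `|l - p (z n)| <= 2 * C * 2 ^- n.
  move=> pR pB p1; apply: (real_geometric_limit (scalars_complex R)) => // n.
  by rewrite -pB; apply: le_trans (p1 _) (wC n).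
have [|||a aw] := part (fun x => 'Re x).
- exact: Creal_Re.
- by move=> x y; rewrite raddfB.
- by move=> x; exact: (leif_normC_Re_Creal x).1.
have [|||b bw] := part (fun x => 'Im x).
- exact: Creal_Im.
- by move=> x y; rewrite raddfB.
- move=> x /=; rewrite -normrN -ReMil.
  apply: le_trans (leif_normC_Re_Creal _).1 _.
  by rewrite normrM normCi mul1r.
exists (a + 'i * b) => n.
have -> : a + 'i * b - w n = (a - 'Re (z n)) + 'i * (b - 'Im (z n)).
  by rewrite mulrBr addrACA -opprD -Crect.
apply: le_trans (ler_normD _ _) _; rewrite normrM normCi mul1r.
apply: le_trans (lerD (aw n) (bw n)) _.
by rewrite le_eqVlt; apply/orP; left; apply/eqP; ring.
Qed.

(** Limits are taken pointwise. The rate at [x] is proportional to the norm of [x], which gives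
    convergence in operator norm. *)
Lemma dual_complete (K : numFieldType) (hK : real_or_complex K)
  (X : normedModType K) : geometrically_complete (dual hK X).
Proof.
move=> C w C0 wC.
have wCx x n : `|w n.+1 x - w n x| <= C * `|x| * 2 ^- n.
  apply: le_trans (op_norm_bound (w n.+1 - w n) x) _.
  by rewrite [leRHS]mulrAC ler_wpM2r//; exact: wC.
have lim x : exists l : K^o, forall n, `|l - w n x| <= 4 * C * `|x| * 2 ^- n.
  have [|l lP] := scalar_complete hK (mulr_ge0 C0 (normr_ge0 x)) (w := w ^~ x).
    exact: wCx.
  by exists l => n; rewrite -(mulrA 4).
have [l lP] := choice lim.
have llin : linear l.
  move=> k x y; apply/eqP; rewrite -subr_eq0 -normr_le0.
  pose D := 4 * C * `|k *: x + y| + (`|k| * (4 * C * `|x|) + 4 * C * `|y|).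
  apply: (@ler_exp_half K hK D).
    by rewrite !(addr_ge0, mulr_ge0).
  move=> n; rewrite add0r.
  have wE : w n (k *: x + y) = k * w n x + w n y := linearP (w n) k x y.
  have -> : l (k *: x + y) - (k *: l x + l y) =
    (l (k *: x + y) - w n (k *: x + y)) - (k * (l x - w n x) + (l y - w n y)).
    by rewrite wE -[k *: l x]/(k * l x); ring.
  apply: le_trans (ler_normB _ _) _; rewrite /D mulrDl; apply: lerD => //.
  apply: le_trans (ler_normD _ _) _; rewrite mulrDl; apply: lerD => //.
  by rewrite normrM -[leRHS]mulrA ler_wpM2l.
have lbound x : `|l x| <= (4 * C + `|w 0%N|) * `|x|.
  rewrite -(subrK (w 0%N x) (l x)); apply: le_trans (ler_normD _ _) _.
  rewrite mulrDl lerD ?op_norm_bound//.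
  by have := lP x 0%N; rewrite expr0 invr1 mulr1.
have lB : 0 <= 4 * C + `|w 0%N| by rewrite addr_ge0// mulr_ge0.
exists (BoundedOp hK (bounded_continuous_linear llin lB lbound)) => n.
apply: op_norm_least => x x1; apply: le_trans (lP x n) _.
by rewrite mulrAC -[leRHS]mulr1 ler_wpM2l// !mulr_ge0// ltW// exp_half_gt0.
Qed.

(** * Fixed points of compact groups of isometries *)

Lemma mean_const (K : numFieldType) (n : nat) (b : K) :
  n.+1%:R^-1 * (\sum_(i < n.+1) b) = b.
Proof.
by rewrite sumr_const card_ord -[b *+ _]mulr_natl mulrA mulVf ?pnatr_eq0// mul1r.
Qed.

Lemma norm_mean_sub (K : numFieldType) (V : normedModType K) (n : nat)
    (x : 'I_n.+1 -> V) (c : V) (b : 'I_n.+1 -> K) :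
  (forall i, `|x i - c| <= b i) ->
  `|n.+1%:R^-1 *: (\sum_i x i) - c| <= n.+1%:R^-1 * \sum_i b i.
Proof.
move=> xb; have -> : n.+1%:R^-1 *: (\sum_i x i) - c =
    n.+1%:R^-1 *: \sum_i (x i - c).
  rewrite big_split/= scalerDr sumr_const card_ord -[(- c) *+ _]scaler_nat.
  by rewrite scalerA mulVf ?pnatr_eq0// scale1r.
rewrite normrZ ger0_norm ?invr_ge0// ler_wpM2l ?invr_ge0//.
by apply: le_trans (ler_norm_sum _ _ _) _; apply: ler_sum.
Qed.

Section isometric_action.
Context (K : numFieldType) (V : normedModType K).
Context (T : Type) (a : T -> V -> V) (G : set T).

(** For a group action these are convex combinations of points of the orbit of [v]; the iterated
    form suits repeated averaging. *)
Inductive orbit_mean (v : V) : V -> Prop :=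
| orbit_mean_refl : orbit_mean v v
| orbit_mean_step w n (g : 'I_n.+1 -> T) : (forall i, G (g i)) ->
    orbit_mean v w -> orbit_mean v (n.+1%:R^-1 *: \sum_i a (g i) w).

Lemma orbit_mean_trans u v w :
  orbit_mean u v -> orbit_mean v w -> orbit_mean u w.
Proof.
by move=> uv; elim=> // {}w n g Gg _; exact: orbit_mean_step.
Qed.

(** [action_comp] leaves [k] free so as to include the order-reversing action on the dual.
    [action_net] is compactness in the form used: total boundedness in operator norm. *)
Record isometric_action : Prop := {
  action_linear : forall g, linear (a g);
  action_norm : forall g, G g -> forall v, `|a g v| = `|v|;
  action_comp : forall g h, G g -> G h ->
    exists2 k, G k & forall v, a g (a h v) = a k v;
  action_inv : forall g, G g -> exists2 h, G h & forall v, a h (a g v) = v;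
  action_net : forall e, 0 < e -> exists n (g : 'I_n.+1 -> T),
    (forall i, G (g i)) /\
    forall h, G h -> exists i, forall v, `|a h v - a (g i) v| <= e * `|v|
}.

Context (aP : isometric_action).

Let aB g x y : a g (x - y) = a g x - a g y.
Proof.
by rewrite addrC -scaleN1r (action_linear aP) scaleN1r addrC.
Qed.

Let amean g n (x : 'I_n.+1 -> V) :
  a g (n.+1%:R^-1 *: \sum_i x i) = n.+1%:R^-1 *: \sum_i a g (x i).
Proof.
pose gL := GRing.isLinear.Build K V V *:%R (a g) (action_linear aP g).
pose f : {linear V -> V} := HB.pack (a g) gL.
by rewrite -[a g]/(f : V -> V) linearZ linear_sum.
Qed.

Lemma orbit_mean_norm v w : orbit_mean v w -> `|w| <= `|v|.
Proof.
elim=> // {}w n g Gg _ wv; rewrite -[X in `|X|]subr0.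
apply: le_trans (norm_mean_sub (b := fun=> `|v|) _) _.
  by move=> i; rewrite subr0 action_norm.
by rewrite mean_const.
Qed.

(** Applying [g] to a mean gives the mean of the translated points, and balls are convex. *)
Lemma orbit_mean_dist v w (D : K) : (forall g, G g -> `|a g v - v| <= D) ->
  orbit_mean v w -> forall g, G g -> `|a g w - v| <= D.
Proof.
move=> vD; elim=> // {}w n k Gk _ wD g Gg; rewrite amean.
apply: le_trans (norm_mean_sub (b := fun=> D) _) _.
  by move=> i; have [h Gh ->] := action_comp aP Gg (Gk i); exact: wD.
by rewrite mean_const.
Qed.

Lemma orbit_mean_invariant (f : V -> K) v w : linear (f : V -> K^o) ->
  (forall g, G g -> forall x, f (a g x) = f x) -> orbit_mean v w -> f w = f v.
Proof.
move=> fl fG.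
pose fL := GRing.isLinear.Build K V K^o *:%R f fl.
pose F : {linear V -> K^o} := HB.pack f fL.
elim=> // {}w n g Gg _ <-.
rewrite -[f]/(F : V -> K) linearZ linear_sum/=.
under eq_bigr => i _ do rewrite fG//.
exact: mean_const.
Qed.

(* Averaging over a net [g] of [G] brings [w] closer to every point of its
   orbit, since each such point is close to some [a (g i) w]. *)
Lemma orbit_mean_contract (e : K) n (g : 'I_n.+1 -> T) w (M D : K) :
  (forall i, G (g i)) ->
  (forall h, G h -> exists i, forall v, `|a h v - a (g i) v| <= e * `|v|) ->
  0 <= e -> `|w| <= M -> (forall h, G h -> `|a h w - w| <= D) ->
  let w' := n.+1%:R^-1 *: \sum_i a (g i) w in
  forall h, G h -> `|a h w' - w'| <= e * M + (1 - n.+1%:R^-1) * (D - e * M).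
Proof.
move=> Gg net e0 wM wD w'.
have step k : G k -> `|a k w - w'| <= e * M + (1 - n.+1%:R^-1) * (D - e * M).
  move=> Gk; have [j kj] := net k Gk.
  (* The net point [j] is close to [k]; the other terms are only within [D]. Averaging thus removes
     the fraction [n.+1%:R^-1] of the excess [D - e * M]. *)
  pose b i : K := if i == j then e * M else D.
  rewrite distrC; apply: le_trans (norm_mean_sub (b := b) _) _.
    move=> i; rewrite /b; case: eqP => [->|_].
      by rewrite distrC; apply: le_trans (kj w) _; rewrite ler_wpM2l.
    have [h Gh hk] := action_inv aP Gk; have [h' Gh' h'E] := action_comp aP Gh (Gg i).
    by rewrite -(action_norm aP Gh) aB h'E hk; exact: wD.
  rewrite (bigD1 j)//= /b eqxx (eq_bigr (fun=> D)); last by move=> i /negPf->.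
  rewrite sumr_const cardC1 card_ord -[D *+ _]mulr_natl.
  have n1 : n.+1%:R = 1 + n%:R :> K by rewrite -natr1 addrC.
  rewrite le_eqVlt; apply/orP; left; apply/eqP.
  have : n.+1%:R != 0 :> K by rewrite pnatr_eq0.
  rewrite n1 => n0; field.
  by rewrite addrC.
move=> h Gh; rewrite {1}/w' amean.
apply: le_trans (norm_mean_sub
  (b := fun=> e * M + (1 - n.+1%:R^-1) * (D - e * M)) _) _.
  by move=> i; have [k Gk ->] := action_comp aP Gh (Gg i); exact: step.
by rewrite mean_const.
Qed.

Context (hK : real_or_complex K).

(** With [x = n.+1%:R^-1] and [k = m * n.+1], Bernoulli's inequality gives [m <= (1 + x) ^+ k],
    while [(1 - x) * (1 + x) <= 1]. *)
Lemma exp_contraction_le (n : nat) (C e : K) : 0 <= C -> 0 < e ->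
  exists k, (1 - n.+1%:R^-1) ^+ k * C <= e.
Proof.
move=> C0 e0; set x : K := n.+1%:R^-1.
have x0 : 0 <= x by rewrite invr_ge0.
have x1 : x <= 1 by rewrite invf_le1 ?ltr0n// ler1n.
have c0 : 0 <= 1 - x by rewrite subr_ge0.
have bernoulli k : 1 + k%:R * x <= (1 + x) ^+ k.
  elim: k => [|k IH]; first by rewrite mul0r addr0 expr0.
  rewrite exprS; apply: le_trans (ler_wpM2l _ IH); last by rewrite addr_ge0.
  rewrite -natr1 mulrDl mul1r mulrDr mulr1 mulrDl mul1r -!addrA lerD2l.
  by rewrite addrCA lerD2l lerDl !mulr_ge0.
have [m Cm] := scalar_natr_bound hK (divr_ge0 C0 (ltW e0)).
exists (m * n.+1)%N.
have mx : m%:R <= (1 + x) ^+ (m * n.+1).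
  apply: le_trans (bernoulli _); rewrite natrM -mulrA mulfV ?pnatr_eq0// mulr1.
  by rewrite lerDr.
move: Cm; rewrite ltr_pdivrMr// => /ltW Cm.
apply: le_trans (ler_wpM2l (exprn_ge0 _ c0) Cm) _.
rewrite mulrA ger_pMl//; apply: le_trans (ler_wpM2l (exprn_ge0 _ c0) mx) _.
rewrite -exprMn exprn_ile1//; first by rewrite mulr_ge0// addr_ge0.
by rewrite mulrBl mul1r mulrDr mulr1 -addrA gerDl opprD addrA subrr sub0r oppr_le0 mulr_ge0.
Qed.

Lemma orbit_mean_almost_fixed v (eta : K) : 0 < eta ->
  exists2 w, orbit_mean v w & forall g, G g -> `|a g w - w| <= eta.
Proof.
move=> eta0; set M := `|v|; have M0 : 0 <= M by exact: normr_ge0.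
have M1 : 0 < M + 1 by rewrite ltr_wpDl.
(* Iteration cannot go below [e * M], so this is made at most [eta / 2]; [M + 1] avoids dividing by
   zero when [v = 0]. *)
pose e := eta / 2 / (M + 1).
have eta2 : 0 < eta / 2 by rewrite divr_gt0.
have e0 : 0 < e by rewrite divr_gt0.
have eM : e * M <= eta / 2.
  by rewrite /e mulrAC ler_pdivrMr// ler_wpM2l ?(ltW eta2)// lerDl.
have [n [g [Gg net]]] := action_net aP e0.
have iterate k : exists2 w, orbit_mean v w & forall h, G h ->
    `|a h w - w| <= e * M + (1 - n.+1%:R^-1) ^+ k * (2 * M).
  elim: k => [|k [w vw wD]].
    exists v => [|h Gh]; first exact: orbit_mean_refl.
    apply: le_trans (ler_normB _ _) _; rewrite action_norm// expr0 mul1r.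
    by rewrite mulr_natl mulr2n lerDr mulr_ge0// ltW.
  exists (n.+1%:R^-1 *: \sum_i a (g i) w); first exact: orbit_mean_step.
  move=> h Gh.
  have := orbit_mean_contract Gg net (ltW e0) (orbit_mean_norm vw) wD Gh.
  by rewrite (addrC (e * M) (_ ^+ _ * _)) addrK mulrA -exprS.
have [k ck] := exp_contraction_le n (mulr_ge0 (ler0n K 2) (normr_ge0 v)) eta2.
have [w vw wD] := iterate k; exists w => // h /wD hw; apply: le_trans hw _.
by rewrite [leRHS]splitr lerD.
Qed.

(** Each [s n.+1] is a mean of [s n], whose orbit stays within [2 ^- n] of it; hence the sequence
    converges geometrically, and the orbit of its limit is a single point. *)
Lemma exists_fixed_mean (v : V) : geometrically_complete V ->
  exists w, (forall g, G g -> a g w = w) /\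
    forall n, exists2 w', orbit_mean v w' & `|w - w'| <= 4 * 2 ^- n.
Proof.
move=> cV.
pose good n w := forall g, G g -> `|a g w - w| <= 2 ^- n.
have next n u : exists2 w, orbit_mean u w & good n w.
  exact: orbit_mean_almost_fixed (exp_half_gt0 K n).
have [s0 vs0 gs0] := next 0%N v.
have /choice[f fP] (p : nat * V) : exists w, orbit_mean p.2 w /\ good p.1 w.
  by have [w pw gw] := next p.1 p.2; exists w.
pose s := fix s n := if n is m.+1 then f (n, s m) else s0.
have sg n : good n (s n) by case: n => [//|n]; exact: (fP (_, _)).2.
have ss n : orbit_mean (s n) (s n.+1) by exact: (fP (_, _)).1.
have vs n : orbit_mean v (s n).
  by elim: n => [//|n IH]; exact: orbit_mean_trans IH (ss n).
(* An identity element is recovered from inverses and composition; it turns a bound on orbits into a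
   bound on the points themselves. *)
have [e Ge eE] : exists2 e, G e & forall v, a e v = v.
  have [n [g [Gg _]]] := action_net aP ltr01.
  have [h Gh hE] := action_inv aP (Gg ord0).
  have [k Gk kE] := action_comp aP Gh (Gg ord0).
  by exists k => // x; rewrite -kE hE.
have [||w wP] := cV 1 s; first exact: ler01.
  move=> n; rewrite mul1r -{1}(eE (s n.+1)).
  exact: (orbit_mean_dist (@sg n) (ss n)).
exists w; split => [g Gg|n]; last by exists (s n) => //; have := wP n; rewrite mulr1.
(* Here [9 = 4 + 1 + 4]: the distance from [w] to [s n] counts twice, the orbit of [s n] once. *)
apply/eqP; rewrite -subr_eq0 -normr_le0; apply: (@ler_exp_half K hK 9) => // n.
rewrite add0r (_ : a g w - w = a g (w - s n) + (a g (s n) - s n) - (w - s n)).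
  apply: le_trans (ler_normB _ _) _; apply: le_trans (lerD (ler_normD _ _) (wP n)) _.
  rewrite action_norm// mulr1; apply: le_trans (lerD (lerD (wP n) (sg n g Gg)) (lexx _)) _.
  by rewrite mulr1 le_eqVlt; apply/orP; left; apply/eqP; ring.
by rewrite aB addrA subrK opprB addrA subrK.
Qed.

End isometric_action.

(** * The Hahn-Banach theorem *)

Definition sublinear (K : numFieldType) (V : lmodType K) (p : V -> K) :=
  [/\ forall x, p x \is Num.real, forall x y, p (x + y) <= p x + p y &
      forall t x, 0 <= t -> p (t *: x) = t * p x].

Section sublinear.
Context (K : numFieldType) (V : lmodType K).
Implicit Types p q : V -> K.

Lemma sublinear0 p : sublinear p -> p 0 = 0.
Proof. by move=> [_ _ pZ]; rewrite -(scale0r 0) pZ// mul0r. Qed.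

Lemma sublinear_ge p x : sublinear p -> - p (- x) <= p x.
Proof.
move=> sp; have [pR pD _] := sp.
by rewrite -subr_ge0 opprK -(sublinear0 sp) -{1}(subrr x).
Qed.

(** The reverse inequality for [t] is the given one for [t^-1], applied at [t *: x]. *)
Lemma sublinear_of_le p : (forall x, p x \is Num.real) -> p 0 = 0 ->
  (forall x y, p (x + y) <= p x + p y) ->
  (forall t x, 0 < t -> p (t *: x) <= t * p x) -> sublinear p.
Proof.
move=> pR p0 pD pZ; split=> // t x; rewrite le_eqVlt => /orP[/eqP<-|t0].
  by rewrite scale0r mul0r.
apply/eqP; rewrite eq_le pZ//= -ler_pdivlMl//.
have := pZ t^-1 (t *: x); rewrite invr_gt0 => /(_ t0).
by rewrite scalerA mulVf ?scale1r// gt_eqF.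
Qed.

Lemma additive_sublinear p : sublinear p ->
  (forall x y, p x + p y <= p (x + y)) -> real_linear p.
Proof.
move=> sp pD'; have [pR pD pZ] := sp.
have add x y : p (x + y) = p x + p y by apply/eqP; rewrite eq_le pD pD'.
have opp x : p (- x) = - p x.
  by apply/eqP; rewrite -addr_eq0 -add addNr sublinear0.
split=> // t x tR; case/orP: (tR) => t0; first exact: pZ.
by rewrite -[LHS]opprK -opp -scaleNr pZ ?oppr_ge0// mulNr opprK.
Qed.

Context (hK : real_or_complex K).

Lemma pointwise_glb (I : Type) (A : set I) (F : I -> V -> K) (m : V -> K) :
  A !=set0 -> (forall i x, A i -> m x <= F i x) ->
  exists r, forall x, [/\ m x <= r x, forall i, A i -> r x <= F i x &
    forall b, (forall i, A i -> b <= F i x) -> b <= r x].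
Proof.
move=> [i0 Ai0] mF.
suff /choice[r rP] : forall x, exists rx, [/\ m x <= rx,
    forall i, A i -> rx <= F i x &
    forall b, (forall i, A i -> b <= F i x) -> b <= rx] by exists r.
move=> x; have [||s [ms sF Fs]] := @scalar_glb K hK (F ^~ x @` A) (m x).
- by exists (F i0 x), i0.
- by move=> _ [i Ai <-]; exact: mF.
exists s; split=> // [i Ai|b bF]; first by apply: sF; exists i.
by apply: Fs => _ [i Ai <-]; exact: bF.
Qed.

Lemma sublinear_chain_bound p (A : set {q | sublinear q /\ forall x, q x <= p x}) :
  A !=set0 ->
  (forall s t, A s -> A t ->
    (forall x, sval t x <= sval s x) \/ (forall x, sval s x <= sval t x)) ->
  exists r, sublinear r /\ forall s, A s -> forall x, r x <= sval s x.
Proof.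
move=> A0 tot; have [[q0 [sq0 q0p]] Aq0] := A0.
have [|r rP] := @pointwise_glb _ A sval (fun x => - p (- x)) A0.
  move=> [q [sq qp]] x _ /=; apply: le_trans (sublinear_ge x sq).
  by rewrite lerN2.
have rA s x : A s -> r x <= sval s x by move=> As; have [_ + _] := rP x; apply.
have rG x b : (forall s, A s -> b <= sval s x) -> b <= r x.
  by have [_ _] := rP x; apply.
exists r; split; last by move=> q Aq x; exact: rA.
apply: sublinear_of_le.
- move=> x; have [qR _ _] := sq0; have := rA _ x Aq0 => /=.
  by move=> rq; rewrite -(subrK (q0 x) (r x)) rpredD// ler0_real// subr_le0.
- apply/eqP; rewrite eq_le; apply/andP; split.
    by have /= := rA _ 0 Aq0; rewrite (sublinear0 sq0).
  by apply: (rG) => -[q [sq qp]] _ /=; rewrite (sublinear0 sq).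
- move=> x y; rewrite -lerBlDr; apply: (rG) => q Aq.
  rewrite lerBlDr -lerBlDl; apply: (rG) => q' Aq'.
  rewrite lerBlDl.
  (* Two members of a chain are comparable, and the smaller one serves for both arguments. *)
  wlog qq' : x y q q' Aq Aq' / forall x, sval q x <= sval q' x.
    move=> h; have [|] := tot _ _ Aq Aq'; last exact: h.
    by move=> h'; rewrite addrC [in leRHS]addrC; exact: h.
  apply: le_trans (rA _ _ Aq) _; case: q Aq qq' => q [sq qp] Aq /= qq'.
  by have [_ qD _] := sq; apply: le_trans (qD _ _) _; rewrite lerD2l.
- move=> t x t0; rewrite -ler_pdivrMl//; apply: (rG) => q Aq.
  rewrite ler_pdivrMl//; apply: le_trans (rA _ _ Aq) _.
  by case: q {Aq} => q [[_ _ qZ] _] /=; rewrite qZ// ltW.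
Qed.

(* A minimal [q] is additive: the sublinear functional
   [x |-> inf_(t >= 0) q (x + t y) - t q y] lies below it. *)
Lemma sublinear_shift q y : sublinear q -> exists r, [/\ sublinear r,
  forall x, r x <= q x & forall x, r x <= q (x + y) - q y].
Proof.
move=> sq; have [qR qD qZ] := sq.
pose A : set K := [set t | 0 <= t]; pose F t x := q (x + t *: y) - t * q y.
have [||r rP] := @pointwise_glb K A F (fun x => - q (- x)).
- by exists 0; rewrite /A/=.
- move=> t x t0; rewrite /F -qZ// lerBrDl lerBlDr.
  by have := qD (x + t *: y) (- x); rewrite addrAC subrr add0r.
have rA t x : 0 <= t -> r x <= F t x by move=> t0; have [_ + _] := rP x; apply.
have rG x b : (forall t, 0 <= t -> b <= F t x) -> b <= r x.
  by have [_ _] := rP x; apply.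
have rq x : r x <= q x.
  by apply: le_trans (rA 0 x _) _; rewrite // /F scale0r mul0r subr0 addr0.
exists r; split=> // [|x]; last first.
  by apply: le_trans (rA 1 x _) _; rewrite // /F scale1r mul1r.
apply: sublinear_of_le.
- by move=> x; rewrite -(subrK (q x) (r x)) rpredD// ler0_real// subr_le0.
- apply/eqP; rewrite eq_le; apply/andP; split.
    by have := rq 0; rewrite (sublinear0 sq).
  by have [+ _ _] := rP 0; rewrite oppr0 (sublinear0 sq) oppr0.
- move=> x x'; rewrite -lerBlDr; apply: (rG) => t t0.
  rewrite lerBlDr -lerBlDl; apply: (rG) => t' t'0; rewrite lerBlDl.
  (* The shifts add up: [F (t + t') (x + x') <= F t x + F t' x']. *)
  apply: le_trans (rA (t + t') _ (addr_ge0 t0 t'0)) _.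
  rewrite /F scalerDl addrACA mulrDl opprD [leRHS]addrACA lerD2r.
  exact: qD.
- move=> t x t0; rewrite -ler_pdivrMl//; apply: (rG) => s s0.
  rewrite ler_pdivrMl//; apply: le_trans (rA (t * s) _ (mulr_ge0 (ltW t0) s0)) _.
  by rewrite /F -scalerA -scalerDr qZ ?(ltW t0)// -mulrA -mulrBr.
Qed.

(** Zorn's lemma for the reversed order [R] gives a minimal sublinear [q] below [p]. Minimality
    against [sublinear_shift] makes [q] superadditive, hence additive. *)
Lemma sublinear_minorant p : sublinear p ->
  exists2 f, real_linear f & forall x, f x <= p x.
Proof.
move=> sp; pose T := {q | sublinear q /\ forall x, q x <= p x}.
pose R (s t : T) := `[< forall x, sval t x <= sval s x >].
have p0 : T by exists p.
have [|||[q [sq qp]] qmin] := @ZL_preorder T p0 R.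
- by move=> t; apply/asboolP.
- move=> r s t /asboolP rs /asboolP st; apply/asboolP => x.
  by apply: le_trans (rs x).
- move=> A tot; have [->|/set0P A0] := eqVneq A set0; first by exists p0.
  have [|r [sr rA]] := sublinear_chain_bound A0.
    by move=> s t As At; have [/asboolP|/asboolP] := tot s t As At; [left|right].
  have [s As] := A0.
  have rp : sublinear r /\ forall x, r x <= p x.
    by split=> // x; apply: le_trans (rA _ As x) _; case: s {As} => s [].
  by exists (exist _ r rp) => t At; apply/asboolP => x; exact: rA.
exists q => //; apply: additive_sublinear => // x y.
have [r [sr rq rxy]] := sublinear_shift y sq.
have rp : sublinear r /\ forall x, r x <= p x.
  by split=> // z; exact: le_trans (qp z).
have /asboolP/(_ x)/= qr : R (exist _ r rp) (exist _ q (conj sq qp)).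
  by apply: qmin; apply/asboolP.
by rewrite -lerBrDr; apply: le_trans qr (rxy x).
Qed.

End sublinear.

(** * Complex functionals and their real parts *)

Lemma complexification (C : numClosedFieldType) (V : lmodType C) (f : V -> C) :
  real_linear f -> exists2 F : V -> C^o, linear F & forall x, 'Re (F x) = f x.
Proof.
move=> [fR fD fZ].
have fN x : f (- x) = - f x by rewrite -scaleN1r fZ ?mulN1r// rpredN1.
have fk k x : f (k *: x) = 'Re k * f x + 'Im k * f ('i *: x).
  rewrite {1}[k]Crect scalerDl (mulrC 'i) -scalerA fD.
  by rewrite (fZ ('Re k)) ?(fZ ('Im k)) ?Creal_Re ?Creal_Im.
have fi x : f ('i *: ('i *: x)) = - f x by rewrite scalerA mulCii scaleN1r.
(* The real part determines a linear [F], since the imaginary part of [F x] is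
   [- 'Re (F ('i *: x))]. *)
exists (fun x => f x - 'i * f ('i *: x)) => [k x y|x]; last first.
  by rewrite -mulrN -fN Re_rect ?fR.
have -> : k *: (f x - 'i * f ('i *: x) : C^o) + (f y - 'i * f ('i *: y)) =
  ('Re k + 'i * 'Im k) * (f x - 'i * f ('i *: x)) + (f y - 'i * f ('i *: y)).
  by rewrite -Crect.
have -> : 'i *: (k *: x + y) = k *: ('i *: x) + 'i *: y.
  by rewrite scalerDr !scalerA mulrC.
rewrite !fD (fk k x) (fk k ('i *: x)) fi.
set a := 'Re k; set b := 'Im k; set u := f x; set v := f _; set w := f y.
set z := f _.
apply/eqP; rewrite -subr_eq0.
(* With ['i] treated as an indeterminate, the two sides differ by a multiple of [1 + 'i * 'i]. *)
have -> : a * u + b * v + w - 'i * (a * v + b * - u + z) -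
  ((a + 'i * b) * (u - 'i * v) + (w - 'i * z)) =
  b * v * (1 + 'i * 'i) by ring.
by rewrite mulCii subrr mulr0.
Qed.

(** Lets both scalar fields share one Hahn-Banach proof: [re] is the identity over the reals and
    ['Re] over the complex numbers. *)
Lemma exists_real_part (K : numFieldType) (hK : real_or_complex K) :
  exists re : K -> K,
    [/\ real_linear (re : K^o -> K), forall x, re x <= `|x|,
        forall x, 0 <= x -> re x = x &
        forall (V : lmodType K) (f : V -> K), real_linear f ->
          exists2 F : V -> K^o, linear F & forall x, re (F x) = f x].
Proof.
case: K / hK => R.
  exists id; split=> // [|x|V f [fR fD fZ]]; last 1 first.
  - by exists f => // k x y; rewrite fD fZ// num_real.
  - by split=> // x; exact: num_real.
  - exact: ler_norm.
exists (fun x : R[i] => 'Re x); split.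
- split=> [x|x y|t x tR]; [exact: Creal_Re|exact: raddfD|exact: ReMl].
- by move=> x; exact: (leif_Re_Creal x).1.
- by move=> x /ger0_real/Creal_ReP.
exact: complexification.
Qed.

(** * Norm-preserving extensions and evaluation functionals *)

Definition subspace (K : numFieldType) (V : lmodType K) (W : set V) :=
  W 0 /\ forall k x y, W x -> W y -> W (k *: x + y).

Lemma subspaceZ (K : numFieldType) (V : lmodType K) (W : set V) k x :
  subspace W -> W x -> W (k *: x).
Proof. by move=> [W0 WP] Wx; rewrite -[_ *: _]addr0; exact: WP. Qed.

Lemma exists_rotation (K : numFieldType) (z : K) :
  exists2 c, `|c| = 1 & c * z = `|z|.
Proof.
have [->|z0] := eqVneq z 0; first by exists 1; rewrite ?normr1// mulr0 normr0.
exists (`|z| / z); last by rewrite mulfVK.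
by rewrite normf_div normr_id mulfV// normr_eq0.
Qed.

Section hahn_banach.
Context (K : numFieldType) (hK : real_or_complex K) (V : normedModType K).

(** The infimum over [w] in [W] of [G w x] is sublinear, at most [M] times the norm, and at most
    [re (phi x)] on [W] (take [w = - x]). A real-linear minorant therefore extends [re] of [phi]. *)
Lemma norm_preserving_extension (W : set V) (phi : V -> K) (M : K) :
  subspace W -> 0 <= M ->
  (forall k x y, W x -> W y -> phi (k *: x + y) = k * phi x + phi y) ->
  (forall x, W x -> `|phi x| <= M * `|x|) ->
  exists2 F : dual hK V, forall x, W x -> F x = phi x &
    forall x, `|F x| <= M * `|x|.
Proof.
move=> sW M0 phiL phiM; have [W0 WP] := sW.
have phi0 : phi 0 = 0.
  have := phiL 1 0 0 W0 W0; rewrite scale1r addr0 mul1r => /eqP.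
  by rewrite -subr_eq0 opprD addrA subrr sub0r oppr_eq0 => /eqP.
have phiZ k x : W x -> phi (k *: x) = k * phi x.
  by move=> Wx; rewrite -[_ *: _]addr0 phiL// phi0 addr0.
have phiD x y : W x -> W y -> phi (x + y) = phi x + phi y.
  by move=> Wx Wy; rewrite -[x in LHS]scale1r phiL// mul1r.
have [re [[reR reD reZ] re_le re_id complexify]] := exists_real_part hK.
have re0 : re 0 = 0 by rewrite re_id.
have reN x : re (- x) = - re x by rewrite -mulN1r reZ ?mulN1r// rpredN1.
pose G w x := M * `|x + w| - re (phi w).
have [||r rP] := @pointwise_glb K V hK V W G (fun x => - (M * `|x|)).
- by exists 0.
- move=> w x Ww; rewrite /G lerBrDl.
  have := le_trans (re_le (phi w)) (phiM _ Ww) => h.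
  rewrite lerBlDr; apply: le_trans h _; rewrite -mulrDr ler_wpM2l//.
  by rewrite -{1}(addKr x w) addrC; apply: le_trans (ler_normB _ _) _.
have rA w x : W w -> r x <= G w x by move=> Ww; have [_ + _] := rP x; apply.
have rG x b : (forall w, W w -> b <= G w x) -> b <= r x.
  by have [_ _] := rP x; apply.
have GR w x : G w x \is Num.real by rewrite rpredB// ger0_real// mulr_ge0.
have rM x : r x <= M * `|x|.
  by apply: le_trans (rA 0 x W0) _; rewrite /G phi0 re0 subr0 addr0.
have sr : sublinear r.
  apply: sublinear_of_le.
  - move=> x; rewrite -(subrK (G 0 x) (r x)) rpredD// ler0_real// subr_le0.
    exact: rA.
  - apply/eqP; rewrite eq_le; apply/andP; split.
      by have := rM 0; rewrite normr0 mulr0.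
    by have [+ _ _] := rP 0; rewrite normr0 mulr0 oppr0.
  - move=> x y; rewrite -lerBlDr; apply: (rG) => w Ww.
    rewrite lerBlDr -lerBlDl; apply: (rG) => w' Ww'; rewrite lerBlDl.
    have Wws : W (w + w') by rewrite -[w]scale1r; exact: WP.
    apply: le_trans (rA _ _ Wws) _.
    rewrite /G phiD// reD opprD [leRHS]addrACA lerD2r -mulrDr ler_wpM2l//.
    by rewrite addrACA; exact: ler_normD.
  - move=> t x t0; rewrite -ler_pdivrMl//; apply: (rG) => w Ww.
    rewrite ler_pdivrMl//; apply: le_trans (rA _ _ (subspaceZ t sW Ww)) _.
    rewrite /G -scalerDr normrZ gtr0_norm// phiZ// reZ ?gtr0_real//.
    by rewrite mulrBr mulrCA.
have [f [fR fD fZ] fr] := sublinear_minorant hK sr.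
have [|F FL Ff] := complexify V f; first by split.
have fphi w : W w -> f w = re (phi w).
  have le_phi x : W x -> f x <= re (phi x).
    move=> Wx; apply: le_trans (fr x) _.
    have := rA _ x (subspaceZ (-1) sW Wx).
    by rewrite /G phiZ// mulN1r reN opprK scaleN1r subrr normr0 mulr0 add0r.
  move=> Ww; apply/eqP; rewrite eq_le le_phi//=.
  have := le_phi _ (subspaceZ (-1) sW Ww).
  by rewrite phiZ// mulN1r reN fZ ?rpredN1// mulN1r lerN2.
pose FL' := GRing.isLinear.Build K V K^o *:%R F FL.
pose Flin : {linear V -> K^o} := HB.pack F FL'.
have FZ k x : F (k *: x) = k * F x by rewrite -[F]/(Flin : V -> K) linearZ.
have FM x : `|F x| <= M * `|x|.
  (* After rotation [F] takes a nonnegative value, which equals its real part. *)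
  have [c c1 cF] := exists_rotation (F x).
  rewrite -cF -FZ -[leLHS]re_id ?FZ ?cF// -cF -FZ Ff.
  by apply: le_trans (fr _) _; apply: le_trans (rM _) _; rewrite normrZ c1 mul1r.
exists (BoundedOp hK (bounded_continuous_linear FL M0 FM)) => //= x Wx.
apply/eqP; rewrite -subr_eq0 -normr_eq0.
(* On [W] the real parts agree, and rotating the difference makes it equal to its own real part. *)
have [c c1 cd] := exists_rotation (F x - phi x).
rewrite -[`|_|]re_id// -cd mulrBr -FZ -phiZ// reD reN Ff fphi ?subrr//.
exact: subspaceZ.
Qed.

Lemma exists_norming_functional (x : V) :
  exists2 f : dual hK V, `|f| <= 1 & f x = `|x|.
Proof.
have [->|x0] := eqVneq x 0.
  by exists 0; rewrite ?normr0// linear0.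
pose W : set V := [set y | exists k, y = k *: x].
pose coef (y : V) : K := xget 0 [set k | y = k *: x].
have coefE k : coef (k *: x) = k.
  rewrite /coef; case: xgetP => [c _ /= /eqP|/(_ k)[]//].
  by rewrite -subr_eq0 -scalerBl scaler_eq0 (negPf x0) orbF subr_eq0 => /eqP.
have [|//|||f fW f1] := @norm_preserving_extension W (fun y => coef y * `|x|) 1.
- split; first by exists 0; rewrite scale0r.
  by move=> j y z [a ->{y}] [b ->{z}]; exists (j * a + b); rewrite scalerDl scalerA.
- move=> j y z [a ->{y}] [b ->{z}].
  by rewrite /= scalerA -scalerDl !coefE mulrDl mulrA.
- by move=> _ [a ->]; rewrite /= coefE normrM normr_id normrZ mul1r.
exists f; first by apply: op_norm_least => y y1; apply: le_trans (f1 y) _; rewrite mul1r.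
have Wx : W x by exists 1; rewrite scale1r.
by rewrite fW//= -[X in coef X]scale1r coefE mul1r.
Qed.

(** Induction on [s]: the kernel of evaluation at [d] is handled by the induction hypothesis, and
    one [z] with [z d != 0] fixes the coefficient of [d]. *)
Lemma functional_of_annihilator (Y : set (dual hK V)) (s : seq V)
    (psi : dual hK V -> K) : subspace Y -> linear (psi : _ -> K^o) ->
  (forall y, Y y -> {in s, forall d, y d = 0} -> psi y = 0) ->
  exists e, forall y, Y y -> psi y = y e.
Proof.
move=> + psiL; elim: s Y => [|d s IH] Y sY psi0.
  by exists 0 => y Yy; rewrite linear0; exact: psi0.
have [Y0 YP] := sY.
have [|y Yy ys|e eP] := IH [set y | Y y /\ y d = 0].
- split=> [|k x y [Yx xd] [Yy yd]]; first by split.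
  by split; [exact: YP|rewrite -[LHS]/(k *: x d + y d) xd yd scaler0 addr0].
- by apply: psi0; [exact: Yy.1|move=> c; rewrite inE => /orP[/eqP->|/ys//]; exact: Yy.2].
have [[z [Yz zd]]|nz] := pselect (exists z, Y z /\ z d != 0); last first.
  exists e => y Yy; apply: eP; split=> //.
  by apply: contrapT => /eqP yd; apply: nz; exists y.
pose c := (psi z - z e) / z d.
exists (c *: d + e) => y Yy.
have -> : y (c *: d + e) = c * y d + y e := linearP y c d e.
pose k := - (y d / z d).
have : k * psi z + psi y = k * z e + y e.
  rewrite -[LHS](psiL k z y : _ = _ + _) eP//; split; first exact: YP.
  by rewrite -[LHS]/(k * z d + y d) mulNr mulfVK// addNr.
move=> /(congr1 (fun t => t - k * psi z)); rewrite addrAC subrr add0r => ->.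
by rewrite /k /c; field.
Qed.

End hahn_banach.

(** Extend [phi] from the annihilator of [s] in [Y] to some [F] bounded by [t]. Then [phi - F]
    vanishes on that annihilator, so on [Y] it is evaluation at some [e]. *)
Lemma approx_by_evaluation (K : numFieldType) (hK : real_or_complex K)
    (V : normedModType K) (Y : set (dual hK V)) (s : seq V)
    (phi : bidual hK V) (t : K) : subspace Y -> 0 <= t ->
  (forall y, Y y -> {in s, forall d, y d = 0} -> `|phi y| <= t * `|y|) ->
  exists e, forall y, Y y -> `|phi y - y e| <= t * `|y|.
Proof.
move=> sY t0 phis; have [Y0 YP] := sY.
pose W := [set y | Y y /\ {in s, forall d, y d = 0}].
have [||k x y _ _|y [Yy ys]|F Fphi Ft] :=
  @norm_preserving_extension K hK (dual hK V) W phi t.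
- split; first by split=> // d _.
  move=> k x y [Yx xs] [Yy ys]; split; first exact: YP.
  by move=> d ds; rewrite -[LHS]/(k *: x d + y d) xs// ys// scaler0 addr0.
- exact: t0.
- exact: linearP.
- exact: phis.
have [|y Yy ys|e eP] := @functional_of_annihilator K hK V Y s (phi - F) sY.
- exact: linearP.
- by rewrite -[LHS]/(phi y - F y) Fphi ?subrr.
exists e => y Yy; rewrite -eP// -[X in `|X|]/(phi y - (phi y - F y)).
by rewrite opprB addrC subrK; exact: Ft.
Qed.

(** * James sequences and strong subdifferentiability *)

Lemma op_norm_approx (K : numFieldType) (hK : real_or_complex K)
    (V : normedModType K) (f : dual hK V) (e : K) : 0 < e ->
  exists2 d, `|d| <= 1 & `|f| - e <= `|f d|.
Proof.
move=> e0; apply: contrapT => nd.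
suff : `|f| <= `|f| - e by rewrite lerBrDr gerDl lt_geF.
apply: op_norm_least => d d1; have : ~ (`|f| - e <= `|f d|) by move=> fd; apply: nd; exists d.
have /orP[//|//] : (`|f d| <= `|f| - e) || (`|f| - e <= `|f d|).
by apply: real_leVge; rewrite ?rpredB ?normr_real// gtr0_real.
Qed.

Section james_sequence.
Context (K : numFieldType) (hK : real_or_complex K) (X : normedModType K).
Context (Y : set (dual hK X)) (phi : bidual hK X) (t : K).

Definition limit_closed := forall (u : dual hK X) (w : nat -> dual hK X) (C : K),
  0 <= C -> (forall n, Y (w n)) -> (forall n, `|u - w n| <= C * 2 ^- n) -> Y u.

Let C (s : seq X) : set (dual hK X) :=
  [set y | [/\ Y y, {in s, forall d, y d = 0}, `|y| <= 1 & phi y = t]].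

Lemma james_step (e : K) (n : nat) (v : dual hK X) (s : seq X) :
  (forall s, C s !=set0) -> 0 < e ->
  exists p : X * dual hK X, [/\ `|p.1| <= 1, `|v| - 2 ^- n <= `|v p.1|,
    C (p.1 :: s) p.2 & forall y, C (p.1 :: s) y ->
      `|v + 2 ^- n *: p.2| <= `|v + 2 ^- n *: y| + e].
Proof.
move=> C0 e0; have [d d1 vd] := op_norm_approx v (exp_half_gt0 K n).
have [//|w Cw wmin] := @exists_near_minimizer K hK _ (C (d :: s))
  (fun y => `|v + 2 ^- n *: y|) e (C0 _) _ e0.
by exists (d, w).
Qed.

(* The tails [w k = 2^k (u - v k)] of the series defining [u] stay in the convex
   sets over which its terms are near minimizers; this forces the partial sums
   [v k = u - 2^-k w k] to be shorter than [u] by [2^-k e]. *)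
Lemma exists_james_sequence : subspace Y -> limit_closed -> 0 < t ->
  (forall s, C s !=set0) ->
  exists (u : dual hK X) (e : K) (w : nat -> dual hK X) (d : nat -> X),
    [/\ Y u, 0 < e, e < `|u| &
     [/\ forall k, Y (w k) /\ `|w k| <= 1,
        forall k, `|u - 2 ^- k *: w k| <= `|u| - 2 ^- k * e,
        forall i, `|d i| <= 1 /\ `|u| - 3 * 2 ^- i <= `|u (d i)| &
        forall i k, (i <= k)%N -> w k (d i) = 0]].
Proof.
move=> sY clY t0 C0; have [Y0 YP] := sY.
have phib y : `|phi y| <= `|phi| * `|y| by exact: op_norm_bound.
have phi_gt0 : 0 < `|phi|.
  have [y [_ _ y1 phiy]] := C0 [::]; apply: (lt_le_trans t0).
  have -> : t = `|phi y| by rewrite phiy gtr0_norm.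
  by apply: le_trans (phib y) _; rewrite -[leRHS]mulr1 ler_wpM2l.
(* Since [phi u = t] will hold, [u] has norm at least [e + e]: one [e] absorbs the minimization
   errors, the other is the gain. *)
pose e := t / `|phi| / 2.
have e0 : 0 < e by rewrite !divr_gt0.
have eps_gt0 n : 0 < e * (2 ^- n * 2 ^- n.+1) by rewrite (mulr_gt0 e0)// mulr_gt0// exp_half_gt0.
have /choice[f fP] (p : nat * (dual hK X * seq X)) : exists q : X * dual hK X,
    [/\ `|q.1| <= 1, `|p.2.1| - 2 ^- p.1 <= `|p.2.1 q.1|,
    C (q.1 :: p.2.2) q.2 & forall y, C (q.1 :: p.2.2) y ->
      `|p.2.1 + 2 ^- p.1 *: q.2| <= `|p.2.1 + 2 ^- p.1 *: y| +
        e * (2 ^- p.1 * 2 ^- p.1.+1)].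
  exact: james_step.
pose st := fix st n : dual hK X * seq X := if n is m.+1 then
  ((st m).1 + 2 ^- m.+1 *: (f (m, st m)).2, (f (m, st m)).1 :: (st m).2)
  else (0, [::]).
pose v n := (st n).1; pose s n := (st n).2.
pose d n := (f (n, st n)).1; pose y n := (f (n, st n)).2.
have vS n : v n.+1 = v n + 2 ^- n.+1 *: y n by [].
have sS n : s n.+1 = d n :: s n by [].
have dP n : `|d n| <= 1 /\ `|v n| - 2 ^- n <= `|v n (d n)|.
  by have [] := fP (n, st n).
have Cy n : C (s n.+1) (y n) by have [] := fP (n, st n).
have ymin n z : C (s n.+1) z -> `|v n + 2 ^- n *: y n| <= `|v n + 2 ^- n *: z| +
    e * (2 ^- n * 2 ^- n.+1) by have [_ _ _] := fP (n, st n); apply.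
have s_sub k n : (k <= n)%N -> {subset s k <= s n}.
  elim: n => [|n IH]; first by rewrite leqn0 => /eqP->.
  rewrite leq_eqVlt => /orP[/eqP->//|]; rewrite ltnS => /IH ks x /ks xs.
  by rewrite sS inE xs orbT.
(* This difference combines the [y j] for [k <= j < k + n] with weights [2 ^- j.+1], whose sum is
   [2 ^- k - 2 ^- (k + n)]. *)
have tail k n : [/\ Y (v (k + n)%N - v k),
    {in s k.+1, forall x, (v (k + n)%N - v k) x = 0},
    `|v (k + n)%N - v k| <= 2 ^- k - 2 ^- (k + n) &
    phi (v (k + n)%N - v k) = t * (2 ^- k - 2 ^- (k + n))].
  elim: n => [|n [IY Is In Ip]].
    by rewrite addn0 !subrr normr0 linear0 mulr0; split=> //.
  rewrite addnS vS addrAC.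
  have [yY ys y1 yp] := Cy (k + n)%N; split.
  - by rewrite addrC; exact: YP.
  - move=> x xs; rewrite -[LHS]/((v (k + n)%N - v k) x + 2 ^- (k + n).+1 * y (k + n)%N x).
    by rewrite Is// ys ?mulr0 ?addr0//; apply: s_sub xs; rewrite ltnS leq_addr.
  - apply: le_trans (ler_normD _ _) _.
    rewrite normrZ gtr0_norm ?exp_half_gt0//.
    apply: le_trans (lerD In (ler_wpM2l (ltW (exp_half_gt0 K _)) y1)) _.
    by rewrite (exp_halfS K (k + n)) mulr1 opprD addrA subrK.
  - rewrite linearD linearZ/= Ip yp (exp_halfS K (k + n)).
    by rewrite -[_ *: _]/(_ * _); ring.
have [|u uv] := @dual_complete K hK X 1 v ler01.
  move=> n; rewrite vS addrAC subrr add0r normrZ gtr0_norm ?exp_half_gt0//.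
  have [_ _ y1 _] := Cy n; apply: le_trans (ler_wpM2l (ltW (exp_half_gt0 K _)) y1) _.
  by rewrite mulr1 mul1r exp_half_le.
have {}uv n : `|u - v n| <= 4 * 2 ^- n by have := uv n; rewrite mulr1.
pose r k := u - v k.
have rE k n : r k = (u - v (k + n)%N) + (v (k + n)%N - v k) by rewrite addrA subrK.
have uvk k n : `|u - v (k + n)%N| <= 4 * 2 ^- n.
  by apply: le_trans (uv _) _; rewrite ler_pM2l// exp_half_le// leq_addl.
have rP k : [/\ Y (r k), {in s k.+1, forall x, r k x = 0}, `|r k| <= 2 ^- k &
    phi (r k) = t * 2 ^- k].
  split.
  - apply: (clY _ (fun n => v (k + n)%N - v k) 4) => // n.
      by have [] := tail k n.
    by rewrite (rE k n) addrK.
  - move=> x xs; apply/eqP; rewrite -normr_le0.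
    apply: (@ler_exp_half K hK (4 * `|x|)) => [|n]; first by rewrite mulr_ge0.
    have [_ /(_ x xs) vx _ _] := tail k n.
    have -> : r k x = (u - v (k + n)%N) x + (v (k + n)%N - v k) x by rewrite (rE k n).
    rewrite add0r vx addr0.
    apply: le_trans (op_norm_bound _ _) _; rewrite mulrAC.
    by rewrite ler_wpM2r//; exact: uvk.
  - apply: (@ler_exp_half K hK 4) => // n; rewrite (rE k n).
    apply: le_trans (ler_normD _ _) _; rewrite addrC lerD//.
    have [_ _ vn _] := tail k n; apply: le_trans vn _.
    by rewrite gerDl oppr_le0 ltW ?exp_half_gt0.
  - apply/eqP; rewrite -subr_eq0 -normr_le0.
    apply: (@ler_exp_half K hK (`|phi| * 4 + t)) => [|n].
      by rewrite addr_ge0 ?mulr_ge0// ltW.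
    have [_ _ _ vp] := tail k n.
    have -> : phi (r k) - t * 2 ^- k = phi (u - v (k + n)%N) - t * 2 ^- (k + n).
      have -> : phi (r k) = phi (u - v (k + n)%N) + phi (v (k + n)%N - v k).
        by rewrite (rE k n) linearD.
      by rewrite vp mulrBr addrA addrAC addrK.
    rewrite add0r mulrDl; apply: le_trans (ler_normB _ _) _; apply: lerD.
      by apply: le_trans (phib _) _; rewrite -mulrA ler_wpM2l.
    rewrite gtr0_norm ?(mulr_gt0 t0) ?exp_half_gt0// ler_pM2l//.
    by rewrite exp_half_le// leq_addl.
pose w k := 2 ^+ k *: r k.
have wE k : 2 ^- k *: w k = r k.
  by rewrite scalerA mulVf ?scale1r// expf_neq0// pnatr_eq0.
have Cw k : C (s k.+1) (w k).
  have [rY rs r1 rp] := rP k; split.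
  - exact: subspaceZ.
  - by move=> x xs; rewrite -[LHS]/(2 ^+ k * r k x) rs// mulr0.
  - by rewrite normrZ gtr0_norm ?exprn_gt0// mulrC -ler_pdivlMr ?exprn_gt0// mul1r.
  - have -> : phi (w k) = 2 ^+ k * phi (r k) by rewrite /w linearZ.
    by rewrite rp mulrCA mulfV ?mulr1// expf_neq0// pnatr_eq0.
have vE k : v k = u - 2 ^- k *: w k by rewrite wE opprB addrC subrK.
pose U := `|u|.
have eU : e + e <= U.
  rewrite -splitr ler_pdivrMr// mulrC.
  have [_ _ _] := rP 0%N; rewrite expr0 invr1 mulr1 /r subr0 => pu.
  by rewrite -[leLHS]gtr0_norm// -pu; exact: phib.
(* Scaled by [2 ^+ k], the gap on the right starts at [U] and loses at most [e * 2 ^- k.+1] at stage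
   [k]; the losses sum to [e * (1 - 2 ^- k)]. *)
have short k : 2 ^- k * (U - e * (1 - 2 ^- k)) <= U - `|v k|.
  elim: k => [|k IH].
    by rewrite expr0 invr1 subrr mulr0 subr0 mul1r normr0 subr0.
  (* The step has half the weight used in the minimization, so [v k.+1] is a midpoint. Its far end
     competes with [v k + 2 ^- k *: w k = u]. *)
  have half : `|v k.+1| <= (`|v k| + `|v k + 2 ^- k *: y k|) / 2.
    have v2 : v k.+1 + v k.+1 = v k + (v k + 2 ^- k *: y k).
      by rewrite vS (exp_halfS K k) scalerDl addrACA -addrA.
    rewrite ler_pdivlMr// mulr_natr -normrMn mulr2n v2.
    exact: ler_normD.
  have vk : `|v k + 2 ^- k *: y k| <= U + e * (2 ^- k * 2 ^- k.+1).
    by apply: le_trans (ymin k _ (Cw k)) _; rewrite vE subrK.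
  have {half vk} h : `|v k.+1| <= (`|v k| + (U + e * (2 ^- k * 2 ^- k.+1))) / 2.
    by apply: le_trans half _; rewrite ler_pM2r ?invr_gt0// lerD2l.
  have vk : `|v k| <= U - 2 ^- k * (U - e * (1 - 2 ^- k)).
    by rewrite lerBrDr addrC -lerBrDr.
  rewrite lerBrDr addrC -lerBrDr; apply: le_trans h _.
  apply: (@le_trans _ _ ((U - 2 ^- k * (U - e * (1 - 2 ^- k)) +
    (U + e * (2 ^- k * 2 ^- k.+1))) / 2)).
    by rewrite ler_pM2r ?invr_gt0// lerD2r.
  rewrite (exp_halfS K k) le_eqVlt; apply/orP; left; apply/eqP.
  by set h := 2 ^- k.+1; field.
exists u, e, w, d; split=> //.
- by have [+ _ _ _] := rP 0%N; rewrite /r subr0.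
- by apply: lt_le_trans eU; rewrite ltrDl.
split.
- by move=> k; have [] := Cw k.
- move=> k; rewrite -vE lerBrDr -lerBrDl; apply: le_trans (short k).
  rewrite ler_pM2l ?exp_half_gt0// lerBrDr.
  by apply: le_trans eU; rewrite lerD2l ger_pMr// gerDl oppr_le0.
(* Three errors of [2 ^- i]: from [u] to [v i] in norm, from [v i] to its value at [d i], and back
   to [u] at [d i]. *)
- move=> i; have [d1 vd] := dP i; split=> //.
  have [_ _ ri _] := rP i.
  have uv1 : U <= `|v i| + 2 ^- i.
    have := ler_normD (r i) (v i); rewrite subrK => h; apply: le_trans h _.
    by rewrite addrC lerD2l.
  have vu : `|v i (d i)| <= `|u (d i)| + 2 ^- i.
    have := ler_normB (u (d i)) (r i (d i)).
    rewrite -[_ - _ in X in X -> _]/((u - r i) (d i)) /r opprB addrC subrK => h.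
    apply: le_trans h _; rewrite lerD2l.
    apply: le_trans (op_norm_bound _ _) _; apply: le_trans (ler_wpM2l _ d1) _.
      exact: op_norm_ge0.
    by rewrite mulr1.
  rewrite lerBlDr; apply: le_trans uv1 _.
  move: vd; rewrite lerBlDr => vd; apply: le_trans (lerD vd (lexx _)) _.
  rewrite -addrA; apply: le_trans (lerD vu (lexx _)) _.
  by rewrite le_eqVlt; apply/orP; left; apply/eqP; ring.
- move=> i k ik; have [_ ws _ _] := Cw k; apply: ws.
  by apply: (s_sub i.+1) => //; rewrite sS inE eqxx.
Qed.

End james_sequence.

(** Cauchy form of the uniform limit: eliminating [l] allows a vanishing step to be compared with a
    fixed one. *)
Lemma uniform_quotient (K : numFieldType) (hK : real_or_complex K)
    (X : normedModType K) (G : set (bounded_op hK X X)) (u : dual hK X) (e : K) :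
  dual_G_SSD G -> dual_fixed_points G u -> `|u| = 1 -> 0 < e ->
  let q (t : K) (z : dual hK X) := (`|u + t *: z| - 1) / t in
  exists2 t0 : K, 0 < t0 & forall a b, 0 < a < t0 -> 0 < b < t0 ->
    forall z, dual_fixed_points G z -> `|z| <= 1 -> `|q a z - q b z| <= e.
Proof.
move=> ssd uG u1 e0 q; have [l lP] := ssd u uG u1.
pose A := dual_fixed_points G `&` [set z : dual hK X | `|z| <= 1].
have e2 : 0 < e / 2 by rewrite divr_gt0.
pose N : set (dual hK X -> K^o) :=
  [set h | forall z, A z -> ball (l z) (e / 2) (h z)].
have Nl : nbhs (l : {uniform` A -> K^o}) N.
  apply/uniform_nbhs; exists [set xy | ball xy.1 (e / 2) xy.2]; split=> //.
  exact: entourage_ball (PosNum e2).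
have := lP N Nl; rewrite /nbhs/= /at_right /within/=.
move=> /nbhs_ballP[t0 /= t0_gt0 t0P].
have qP a z : 0 < a < t0 -> A z -> `|l z - q a z| < e / 2.
  move=> /andP[a0 at0] Az.
  suff: ball (l z) (e / 2) (q a z : K^o) by rewrite -ball_normE.
  apply: t0P => //; rewrite -ball_normE/= sub0r normrN gtr0_norm//.
exists t0 => // a b ha hb z zG z1.
rewrite (_ : q a z - q b z = (l z - q b z) - (l z - q a z)); last first.
  by ring.
apply: le_trans (ler_normB _ _) _.
by rewrite [e]splitr lerD// ltW// qP.
Qed.

Lemma dual_fixed_points_subspace (K : numFieldType) (hK : real_or_complex K)
    (X : normedModType K) (G : set (bounded_op hK X X)) :
  subspace (dual_fixed_points G).
Proof.
split=> [x g Gg //|k x y Yx Yy z g Gg].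
by rewrite -[LHS]/(k *: x (g z) + y (g z)) Yx// Yy.
Qed.

(** Otherwise the James construction applies, and the quotients at the normalized [u] in the
    directions [- w k] contradict [uniform_quotient]. *)
Lemma small_functional_on_annihilator (K : numFieldType) (hK : real_or_complex K)
    (X : normedModType K) (G : set (bounded_op hK X X)) (phi : bidual hK X) (t : K) :
  dual_G_SSD G -> 0 < t -> exists s : seq X, forall y, dual_fixed_points G y ->
    {in s, forall d, y d = 0} -> `|phi y| <= t * `|y|.
Proof.
move=> ssd t0; apply: contrapT => nex.
set Y := dual_fixed_points G in nex.
have sY : subspace Y := dual_fixed_points_subspace G.
have clY : limit_closed Y.
  move=> u w C C0 Yw uw x g Gg; apply/eqP; rewrite -subr_eq0 -normr_le0.
  apply: (@ler_exp_half K hK (C * `|g x| + C * `|x|)) => [|n].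
    by rewrite addr_ge0// mulr_ge0.
  have bound z : `|u z - w n z| <= C * `|z| * 2 ^- n.
    apply: le_trans (op_norm_bound (u - w n) z) _.
    by rewrite mulrAC ler_wpM2r//; exact: uw.
  rewrite add0r mulrDl.
  have -> : u (g x) - u x = (u (g x) - w n (g x)) - (u x - w n x).
    by rewrite (Yw n x g Gg) opprB addrA subrK.
  by apply: le_trans (ler_normB _ _) (lerD _ _).
have C0 (s : seq X) :
    [set y | [/\ Y y, {in s, forall d, y d = 0}, `|y| <= 1 & phi y = t]] !=set0.
  apply: contrapT => nC; apply: nex; exists s => y Yy ys.
  have /orP[//|h] : (`|phi y| <= t * `|y|) || (t * `|y| <= `|phi y|).
    by apply: real_leVge; rewrite ?normr_real// rpredM ?normr_real// gtr0_real.
  have [p0|p0] := eqVneq (phi y) 0; first by rewrite p0 normr0 mulr_ge0// ltW.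
  (* This multiple has [phi] equal to [t], and [h] bounds its norm by 1. *)
  exfalso; apply: nC; exists ((t / phi y) *: y); split.
  - exact: (subspaceZ _ sY Yy).
  - by move=> d ds; rewrite -[LHS]/(t / phi y * y d) ys// mulr0.
  - rewrite normrZ normf_div gtr0_norm// mulrAC ler_pdivrMr ?mul1r//.
    by rewrite normr_gt0.
  - by rewrite linearZ -[LHS]/(t / phi y * phi y) mulfVK.
have [u [e [w [d [Yu e0 eu [wP short dP wd]]]]]] := exists_james_sequence sY clY t0 C0.
have U0 : 0 < `|u| by exact: lt_trans eu.
pose v := `|u|^-1 *: u.
have v1 : `|v| = 1 by rewrite normrZ normfV normr_id mulVf// gt_eqF.
have e4 : 0 < e / 4 by rewrite divr_gt0.
have [r r0 rP] := uniform_quotient ssd (subspaceZ _ sY Yu) v1 e4.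
pose b := r / 2.
have b0 : 0 < b by rewrite divr_gt0.
have br : b < r by rewrite ltr_pdivrMr// ltr_pMr// ltr1n.
have Ub : 0 < `|u| * b by rewrite mulr_gt0.
(* The step [b] stays fixed. Testing at [d i], where [w k] vanishes for [k >= i], loses
   [3 * 2 ^- i]; this [i] keeps the quotient above [- (e / 4)]. *)
have [i hi] := @exp_half_lt K hK 3 (e / 4 * (`|u| * b)) (ler0n K 3) (mulr_gt0 e4 Ub).
have [j hj] := @exp_half_lt K hK 1 (r * `|u|) ler01 (mulr_gt0 r0 U0).
pose k := maxn i j.
(* For this step [v + a *: - w k] is [u - 2 ^- k *: w k] divided by the norm of [u], so [short]
   gives a quotient of at most [- e]. *)
pose a := 2 ^- k / `|u|.
have a0 : 0 < a by rewrite divr_gt0// exp_half_gt0.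
have ar : a < r.
  rewrite ltr_pdivrMr//; apply: le_lt_trans hj; rewrite mul1r.
  by rewrite exp_half_le// leq_maxr.
have [Yw w1] := wP k.
have Yz : Y (- w k) by rewrite -scaleN1r; exact: (subspaceZ _ sY Yw).
have z1 : `|- w k| <= 1 by rewrite normrN.
pose qa := (`|v + a *: - w k| - 1) / a.
pose qb := (`|v + b *: - w k| - 1) / b.
have qab : `|qa - qb| <= e / 4 by apply: rP Yz z1; apply/andP; split.
have qaE : qa <= - e.
  rewrite /qa ler_pdivrMr// lerBlDr /v /a.
  have -> : `|u|^-1 *: u + (2 ^- k / `|u|) *: - w k = `|u|^-1 *: (u - 2 ^- k *: w k).
    by rewrite scalerBr scalerN scalerA mulrC.
  rewrite normrZ normfV normr_id ler_pdivrMl//.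
  apply: le_trans (short k) _.
  have u0 : `|u| != 0 by rewrite gt_eqF.
  rewrite le_eqVlt; apply/orP; left; apply/eqP; set h := 2 ^- k.
  by set U := `|u| in u0 *; field.
have qbE : - (e / 4) <= qb.
  rewrite /qb ler_pdivlMr// lerBrDr.
  have [d1 ud] := dP i.
  have := op_norm_bound (v + b *: - w k) (d i).
  have -> : (v + b *: - w k) (d i) = `|u|^-1 * u (d i).
    rewrite -[LHS]/(`|u|^-1 * u (d i) + b * - (w k (d i))) wd ?leq_maxl//.
    by rewrite oppr0 mulr0 addr0.
  rewrite normrM normfV normr_id => h.
  apply: (@le_trans _ _ (`|u|^-1 * `|u (d i)|)); last first.
    apply: le_trans h _; rewrite -[leRHS]mulr1; apply: ler_wpM2l => //.
    exact: op_norm_ge0.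
  rewrite ler_pdivlMl//; apply: le_trans ud.
  rewrite mulrDr mulr1 [leLHS]addrC lerD2l mulNr mulrN lerN2.
  by rewrite mulrCA ltW.
have : e / 4 + e / 4 < e.
  by rewrite -mulrDl ltr_pdivrMr// -mulr2n -(mulr_natr e 2) ltr_pM2l// ltr_nat.
suff : e <= e / 4 + e / 4 by move=> /le_lt_trans h /h; rewrite ltxx.
have qba : e - e / 4 <= qb - qa by rewrite [leRHS]addrC lerD// lerNr.
rewrite -lerBlDr; apply: (le_trans qba); rewrite -(ger0_norm (x := qb - qa)).
  by rewrite distrC.
apply: le_trans qba; rewrite subr_ge0 ler_pdivrMr// ler_peMr ?ler1n//.
exact: ltW.
Qed.

(** * G-reflexivity *)

Lemma complete_geometrically_complete (K : numFieldType) (hK : real_or_complex K)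
  (X : completeNormedModType K) : geometrically_complete X.
Proof.
move=> C w C0 wC; have dist := geometric_dist wC.
have C2 : 0 <= 2 * C by rewrite mulr_ge0.
have {}dist m n : (n <= m)%N -> `|w m - w n| <= 2 * C * 2 ^- n.
  move=> nm; apply: le_trans (dist _ _ nm) _.
  by rewrite gerDl oppr_le0 mulr_ge0// ltW// exp_half_gt0.
have : cvgn w.
  apply/cauchy_cvgP/cauchy_exP => eps eps0.
  have [N hN] := exp_half_lt hK C2 eps0.
  exists (w N), N => // m /= Nm; rewrite -ball_normE/= distrC.
  exact: le_lt_trans (dist _ _ Nm) hN.
move=> /cvg_ex[l wl]; exists l => n.
apply: (@le_trans _ _ (2 * C * 2 ^- n)); last first.
  by rewrite -!mulrA ler_wpM2r ?ler_nat// mulr_ge0// ltW// exp_half_gt0.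
apply/ler_addgt0Pr => eps eps0.
have [N _ NP] := (@cvgrPdist_le _ _ _ _ _ _ _).1 wl eps eps0.
rewrite -(subrKA (w (maxn N n))); apply: le_trans (ler_normD _ _) _.
rewrite addrC lerD//; first by rewrite dist// leq_maxr.
by apply: NP => /=; rewrite leq_maxl.
Qed.

Lemma compact_net (K : numFieldType) (V : normedModType K) (G : set V) (e : K) :
  compact G -> G !=set0 -> 0 < e -> exists n (g : 'I_n.+1 -> V),
    (forall i, G (g i)) /\ forall h, G h -> exists i, `|h - g i| <= e.
Proof.
rewrite compact_cover => cG [g0 Gg0] e0.
have [|h Gh|D DG Dcov] := cG V G (fun g => ball g e).
- by move=> g _; exact: ball_open.
- by exists h => //; exact: ballxx.
pose r : seq V := finmap.enum_fset D.
have mem h : G h -> exists2 g, g \in r & `|h - g| <= e.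
  move=> /Dcov[g gD]; rewrite -ball_normE/= distrC => /ltW gh; by exists g.
have D0 : (0 < size r)%N.
  by have [g gr _] := mem _ Gg0; rewrite (leq_ltn_trans _ (_ : index g r < _)%N) ?index_mem.
exists (size r).-1, (fun i => nth g0 r i); split=> [i|h Gh].
  apply/set_mem/DG; apply: mem_nth; by rewrite -[X in (_ < X)%N](prednK D0).
have [g gD hg] := mem _ Gh.
have gi : (index g r < (size r).-1.+1)%N.
  by rewrite prednK// index_mem.
by exists (Ordinal gi); rewrite /= nth_index.
Qed.

(** Orbit means do not increase the norm and keep the values of invariant functionals; both facts
    pass to the limit. *)
Lemma fixed_mean_invariant (K : numFieldType) (hK : real_or_complex K)
    (V : normedModType K) (T : Type) (a : T -> V -> V) (G : set T) (v : V) :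
  isometric_action a G -> geometrically_complete V ->
  exists w, [/\ forall g, G g -> a g w = w, `|w| <= `|v| &
    forall F : dual hK V, (forall g, G g -> forall x, F (a g x) = F x) ->
      F w = F v].
Proof.
move=> aP cV; have [w [wG wv]] := exists_fixed_mean aP hK v cV.
exists w; split=> // [|F FG].
  apply: (@ler_exp_half K hK 4) => // n.
  have [w' vw' ww'] := wv n; rewrite -(subrK w' w).
  apply: le_trans (ler_normD _ _) _; rewrite addrC lerD//.
  exact: orbit_mean_norm vw'.
apply/eqP; rewrite -subr_eq0 -normr_le0.
apply: (@ler_exp_half K hK (`|F| * 4)) => [|n]; first by rewrite mulr_ge0.
have [w' vw' ww'] := wv n.
rewrite -(orbit_mean_invariant (@linearP _ _ _ _ F) FG vw') add0r.
have -> : F w - F w' = F (w - w') by rewrite linearB.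
apply: le_trans (op_norm_bound _ _) _; rewrite -mulrA ler_wpM2l//.
exact: op_norm_ge0.
Qed.

Section group.
Context (K : numFieldType) (hK : real_or_complex K) (X : normedModType K).
Context (G : set (bounded_op hK X X)).
Context (GP : compact_isometry_group G).

Let G0 : G !=set0. Proof. by exists (id_op hK X); exact: group_id. Qed.

Lemma group_action : isometric_action (fun (g : bounded_op hK X X) x => g x) G.
Proof.
split.
- by move=> g; exact: linearP.
- exact: group_isometry.
- by move=> g h Gg Gh; exists (comp_op g h) => //; exact: group_comp.
- move=> g Gg; have [h Gh [_ hg]] := group_inv GP Gg; exists h => // v.
  by rewrite -[LHS]/(comp_op h g v) hg.
- move=> e e0; have [n [g [Gg net]]] := compact_net (group_compact GP) G0 e0.
  exists n, g; split=> // h /net[i hi]; exists i => v.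
  by apply: le_trans (op_norm_bound (h - g i) v) _; rewrite ler_wpM2r.
Qed.

Lemma dual_group_action :
  isometric_action (fun (g : bounded_op hK X X) (f : dual hK X) => comp_op f g) G.
Proof.
split.
- by move=> g k f h; exact: bounded_opP.
- move=> g Gg f; apply/eqP; rewrite eq_le; apply/andP; split.
    apply: op_norm_least => x x1; apply: (op_norm_ub f).
    by rewrite (group_isometry GP Gg).
  apply: op_norm_least => y y1; have [x xy] := group_onto GP Gg y.
  rewrite -xy; apply: (op_norm_ub (comp_op f g)).
  by rewrite -(group_isometry GP Gg) xy.
(* Precomposition reverses the order of the factors. *)
- move=> g h Gg Gh; exists (comp_op h g); first exact: group_comp.
  by move=> f; exact: bounded_opP.
- move=> g Gg; have [h Gh [gh _]] := group_inv GP Gg; exists h => // f.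
  apply: bounded_opP => x /=.
  by rewrite -[g (h x)]/(comp_op g h x) gh.
- move=> e e0; have [n [g [Gg net]]] := compact_net (group_compact GP) G0 e0.
  exists n, g; split=> // h /net[i hi]; exists i => f.
  apply: op_norm_least => x x1.
  have -> : (comp_op f h - comp_op f (g i) : dual hK X) x = f ((h - g i) x).
    by rewrite -[LHS]/(f (h x) - f (g i x)) -linearB.
  apply: le_trans (op_norm_bound _ _) _; rewrite mulrC ler_pM//.
  - exact: op_norm_ge0.
  - by apply: le_trans (op_norm_ub _ x1) _.
Qed.

End group.

(** Average [e] to [x] and [f] to [h]. Invariance gives [phi f = phi h] and [f x = h x = h e], so
    the estimate on fixed functionals applies to [h], whose norm is at most that of [f]. *)
Lemma approx_by_fixed_point (K : numFieldType) (hK : real_or_complex K)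
    (X : completeNormedModType K) (G : set (bounded_op hK X X))
    (phi : bidual hK X) (t : K) :
  compact_isometry_group G -> dual_G_SSD G -> bidual_fixed_points G phi ->
  0 < t -> exists2 x, fixed_points G x &
    forall f : dual hK X, `|phi f - f x| <= t * `|f|.
Proof.
move=> GP ssd phiG t0.
have [s sP] := small_functional_on_annihilator phi ssd t0.
have [e eP] := approx_by_evaluation (dual_fixed_points_subspace G) (ltW t0) sP.
have [x [xG _ xe]] := fixed_mean_invariant hK e (group_action GP)
  (@complete_geometrically_complete K hK X).
exists x => // f.
have [h [hG hf hF]] := fixed_mean_invariant hK f (dual_group_action GP)
  (@dual_complete K hK X).
have Yh : dual_fixed_points G h.
  by move=> z g Gg; rewrite -[LHS]/(comp_op h g z) hG.
have <- : phi h = phi f.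
  by apply: hF => g Gg k; rewrite -[in RHS](phiG g Gg).
have <- : h x = f x.
  by apply: (hF (canonical_injection hK x)) => g Gg k /=; rewrite xG.
rewrite xe; last by move=> g Gg z; exact: Yh.
by apply: le_trans (eP _ Yh) _; rewrite ler_pM2l.
Qed.

Theorem theorem41 (K : numFieldType) (hK : real_or_complex K)
    (X : completeNormedModType K) (G : set (bounded_op hK X X)) :
  compact_isometry_group G -> dual_G_SSD G -> G_reflexive G.
Proof.
move=> GP ssd; apply/seteqP; split=> [_ [x xG <-] g Gg|phi phiG].
  by apply: bounded_opP => f /=; rewrite xG.
have /choice[x xP] n : exists x, fixed_points G x /\
    forall f : dual hK X, `|phi f - f x| <= 2 ^- n * `|f|.
  have [x] := approx_by_fixed_point GP ssd phiG (exp_half_gt0 K n).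
  by exists x.
have [|n|l lP] := @complete_geometrically_complete K hK X 2 x.
- exact: ler0n.
(* Both points approximate [phi] on the dual unit ball; a norming functional turns this into a
   distance in [X]. *)
- have [f f1 fE] := exists_norming_functional hK (x n.+1 - x n).
  rewrite -normr_id -fE.
  have fx m : `|phi f - f (x m)| <= 2 ^- m.
    by apply: le_trans ((xP m).2 f) _; rewrite -[leRHS]mulr1 ler_wpM2l.
  have -> : f (x n.+1 - x n) = (phi f - f (x n)) - (phi f - f (x n.+1)).
    by rewrite (linearB f) opprB [RHS]addrC addrA subrK.
  apply: le_trans (ler_normB _ _) _; apply: le_trans (lerD (fx n) (fx n.+1)) _.
  by rewrite mulr_natl mulr2n lerD2l exp_half_le.
have le_f (f : dual hK X) : `|phi f - f l| <= 0.
  apply: (@ler_exp_half K hK (`|f| + `|f| * 8)) => [|n]; first by rewrite addr_ge0// mulr_ge0.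
  have -> : phi f - f l = (phi f - f (x n)) - f (l - x n).
    by rewrite (linearB f) opprB addrA subrK.
  apply: le_trans (ler_normB _ _) _; rewrite add0r mulrDl; apply: lerD.
    by rewrite mulrC; exact: (xP n).2.
  apply: le_trans (op_norm_bound _ _) _; rewrite -mulrA ler_wpM2l//.
    exact: op_norm_ge0.
  by apply: le_trans (lP n) _; rewrite -natrM.
exists l; last by apply: bounded_opP => f /=; apply/eqP; rewrite eq_sym -subr_eq0 -normr_le0.
move=> g Gg; apply/eqP; rewrite -subr_eq0 -normr_le0.
(* The distance from [l] to [x n], at most [4 * 2 * 2 ^- n], counts twice because [g] is an
   isometry. *)
apply: (@ler_exp_half K hK 16) => // n.
have -> : g l - l = g (l - x n) - (l - x n).
  have -> : g (l - x n) = g l - g (x n) by exact: linearB.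
  by rewrite ((xP n).1 g Gg) opprB addrA subrK.
apply: le_trans (ler_normB _ _) _; rewrite (group_isometry GP Gg) add0r.
apply: le_trans (lerD (lP n) (lP n)) _.
by rewrite le_eqVlt; apply/orP; left; apply/eqP; ring.
Qed.
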